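(* Let $F\colon\mathbb{R}^d\to\mathbb{R}$ be bounded from below by $F^*>-\infty$ and $(L_0,L_1)$-smooth with $L_0,L_1\ge 0$, and let the stochastic gradient oracle $\nabla f(\cdot,\xi)$ be unbiased with variance bounded by $\sigma^2$, $\sigma\ge 0$. Set $\beta_t := 1-t^{-1/2}$ and $\eta_t := \frac{t^{-3/4}}{7}$ for $t\ge 1$. Then the iterates $(x_t)$ of NSGD-M with starting point $x_1\in\mathbb{R}^d$, stepsizes $\eta_t$ and moving average parameters $\beta_t$ satisfy $$\frac1T\sum_{t=1}^T \mathbb{E}\big[\|\nabla F(x_t)\|\big]\;\le\;\widetilde{\mathcal O}\!\left(\frac{\Delta_1 e^{L_1^2}+\sigma+e^{L_1^2}L_0}{T^{1/4}}\right),$$ where $\Delta_1 := F(x_1)-F^*$. Here $\widetilde{\mathcal O}$ hides absolute constants and factors polylogarithmic in $T$; that is, there are absolute constants $C,k>0$ (independent of $d,F,F^*,L_0,L_1,\sigma,x_1$, the oracle and $T$) such that for all $T\ge 1$ the left-hand side is at most $C(1+\log T)^k\,\frac{\Delta_1 e^{L_1^2}+\sigma+e^{L_1^2}L_0}{T^{1/4}}$.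
   Context: $d\ge1$ is an integer and $\|\cdot\|$ is the Euclidean norm. $(L_0,L_1)$-smoothness: for $L_0,L_1\ge0$, a differentiable $F\colon\mathbb{R}^d\to\mathbb{R}$ is $(L_0,L_1)$-smooth if for all $x,y\in\mathbb{R}^d$ and all $c>0$ with $L_1\|x-y\|\le c$, $$\|\nabla F(x)-\nabla F(y)\|\le\big(A_0(c)L_0+A_1(c)L_1\|\nabla F(x)\|\big)\|x-y\|,$$ where $A_0(c):=1+e^c-\frac{e^c-1}{c}$ and $A_1(c):=\frac{e^c-1}{c}$. Bounded variance oracle: $\xi$ is a random vector and, for every $x\in\mathbb{R}^d$, $\mathbb{E}[\nabla f(x,\xi)]=\nabla F(x)$ and $\mathbb{E}[\|\nabla f(x,\xi)-\nabla F(x)\|^2]\le\sigma^2$. NSGD-M (Normalized SGD with Momentum): given $x_1\in\mathbb{R}^d$, stepsizes $\eta_t>0$ and parameters $\beta_t\in[0,1)$, set $m_0:=0$ and for $t=1,2,\dots$: sample $\xi_t$ independently from the distribution of $\xi$, and put $g_t:=\nabla f(x_t,\xi_t)$, $m_t:=\beta_t m_{t-1}+(1-\beta_t)g_t$, $x_{t+1}:=x_t-\frac{\eta_t}{\|m_t\|}m_t$. *)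

(* Defs.v *)
From mathcomp Require Import all_boot all_order all_algebra finmap.
From mathcomp Require Import all_classical all_reals all_analysis.

Set Implicit Arguments.
Unset Strict Implicit.
Unset Printing Implicit Defensive.

Import Order.TTheory GRing.Theory Num.Theory.
Import numFieldNormedType.Exports.

Local Open Scope classical_set_scope.
Local Open Scope ring_scope.

(* The canonical norm of 'rV[R]_d is the sup norm, hence a separate Euclidean
   norm; both induce the same topology, so [open], [differentiable] and 'D_v
   may be used as they are. *)
Definition enorm (R : realType) (d : nat) (v : 'rV[R]_d) : R :=
  Num.sqrt (\sum_(i < d) v 0 i ^+ 2).

Definition grad (R : realType) (d : nat) (F : 'rV[R]_d -> R) (x : 'rV[R]_d) :
    'rV[R]_d :=
  \row_(i < d) 'D_(delta_mx 0 i) F x.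

Definition smoothA0 (R : realType) (c : R) : R :=
  1 + expR c - (expR c - 1) / c.

Definition smoothA1 (R : realType) (c : R) : R := (expR c - 1) / c.

Definition L0L1_smooth (R : realType) (d : nat) (L0 L1 : R)
    (F : 'rV[R]_d -> R) : Prop :=
  (forall x, differentiable F x) /\
  forall (x y : 'rV[R]_d) (c : R), 0 < c -> L1 * enorm (x - y) <= c ->
    enorm (grad F x - grad F y) <=
      (smoothA0 c * L0 + smoothA1 c * L1 * enorm (grad F x)) * enorm (x - y).

(* R^d with its Borel sigma-algebra; the carrier is 'rV[R]_d itself. *)
Notation borel_rV R d := (g_sigma_algebraType (@open 'rV[R]_d)).

(* Joint measurability is what makes every g x_t xi_t a random vector. *)
Definition measurable_oracle (R : realType) (d : nat) (disp : measure_display)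
    (Xi : measurableType disp) (g : 'rV[R]_d -> Xi -> 'rV[R]_d) : Prop :=
  measurable_fun [set: borel_rV R d * Xi]
    (fun p : borel_rV R d * Xi => g p.1 p.2 : borel_rV R d).

Section oracle.
Context (R : realType) (d : nat) (disp disp' : measure_display)
  (Omega : measurableType disp) (Xi : measurableType disp')
  (P : probability Omega R).

(* The expectation of a random vector is taken entrywise. *)
Definition unbiased_oracle (F : 'rV[R]_d -> R) (g : 'rV[R]_d -> Xi -> 'rV[R]_d)
    (xi : {RV P >-> Xi}) : Prop :=
  forall (x : 'rV[R]_d) (i : 'I_d),
    P.-integrable setT (fun w => (g x (xi w) 0 i)%:E) /\
    ('E_P[fun w => (g x (xi w) 0 i)%R])%E = (grad F x 0 i)%:E.

Definition bounded_variance_oracle (F : 'rV[R]_d -> R)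
    (g : 'rV[R]_d -> Xi -> 'rV[R]_d) (xi : {RV P >-> Xi}) (sigma : R) : Prop :=
  forall x : 'rV[R]_d,
    ('E_P[fun w => (enorm (g x (xi w) - grad F x) ^+ 2)%R] <=
       ((sigma ^+ 2)%R)%:E)%E.

Definition mutually_independent (I : set nat) (X : nat -> {RV P >-> Xi}) : Prop :=
  forall (J : {fset nat}) (A : nat -> set Xi),
    [set` J] `<=` I -> (forall t, measurable (A t)) ->
    (P (\bigcap_(t in [set` J]) (X t @^-1` A t)) =
     \prod_(t <- J) P (X t @^-1` A t))%E.

(* xis t is meaningful only for t >= 1; xis 0 is unconstrained and unused. *)
Definition iid_samples (xi : {RV P >-> Xi}) (xis : nat -> {RV P >-> Xi}) : Prop :=
  (forall t : nat, (1 <= t)%N ->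
     forall A : set Xi, measurable A ->
       distribution P (xis t) A = distribution P xi A) /\
  mutually_independent [set t | (1 <= t)%N] xis.

End oracle.

(* The state after n steps is (x_{n+1}, m_n). As 0^-1 = 0, the iterate does
   not move at a step where m_n = 0. *)
Fixpoint nsgdm_state (R : realType) (d : nat) (Xi : Type) (eta beta : nat -> R)
    (g : 'rV[R]_d -> Xi -> 'rV[R]_d) (x1 : 'rV[R]_d) (z : nat -> Xi) (n : nat) :
    'rV[R]_d * 'rV[R]_d :=
  match n with
  | 0%N => (x1, 0)
  | n'.+1 =>
      let: (x, m') := nsgdm_state eta beta g x1 z n' in
      let m := beta n *: m' + (1 - beta n) *: g x (z n) in
      (x - (eta n / enorm m) *: m, m)
  end.

(* The iterate x_t for t >= 1; the value at t = 0 is junk. *)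
Definition nsgdm (R : realType) (d : nat) (Xi : Type) (eta beta : nat -> R)
    (g : 'rV[R]_d -> Xi -> 'rV[R]_d) (x1 : 'rV[R]_d) (z : nat -> Xi) (t : nat) :
    'rV[R]_d :=
  (nsgdm_state eta beta g x1 z t.-1).1.

Definition beta_sched (R : realType) (t : nat) : R := 1 - t%:R `^ (- (1 / 2)).

Definition eta_sched (R : realType) (t : nat) : R := t%:R `^ (- (3 / 4)) / 7.

(* Main.v *)
Require Import Defs.
From mathcomp Require Import all_boot all_order all_algebra finmap.
From mathcomp Require Import all_classical all_reals all_analysis.
From mathcomp Require Import measurable_realfun ring lra.
Set Implicit Arguments.
Unset Strict Implicit.
Unset Printing Implicit Defensive.
Import Order.TTheory GRing.Theory Num.Theory.
Import numFieldNormedType.Exports.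
Local Open Scope classical_set_scope.
Local Open Scope ring_scope.

(** The momentum error [m_t - grad F x_t] splits into a noise part, the moving
    average of the centred oracle answers, and a drift part, caused by the
    motion of the gradient along the iterates.

    Noise.  Given the past, the fresh oracle error is centred, so second moments
    obey [V_t <= beta_t^2 V_(t-1) + (1 - beta_t)^2 sigma^2]; with
    [1 - beta_t = t^(-1/2)] this gives [V_t <= sigma^2 t^(-1/2)]
    ([noise_second_moment]).  Conditioning on the past is Tonelli's theorem on
    the product of the laws of the current state and of the next sample
    ([integral_driven_input]); the joint law is a product by a pi-lambda argument
    ([driven_indep_future]).

    Everything else holds along each trajectory, with the noise norms as data.
    The time line is cut at [t = L1^4].

    Late steps, [L1 <= t^(1/4)].  The steps are short enough for the smoothness
    condition to be used at radius 1/4, and the potential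
    [F x_t + (3/7) t^(-1/4) |drift_t|] decreases by [(5/21) eta_t |grad F x_t|]
    at each step, up to the noise term [2 eta_t |noise_t|] and an error of order
    [L0 / t] ([late_potential_step]).  The weight [t^(-1/4)] is chosen so that
    the contraction of the drift pays for its contribution to the descent
    inequality; the terms in [L1 |grad F x_t|] are absorbed because
    [L1 t^(-1/4) <= 1].

    Early steps.  Their total length is at most [(4/7) L1], since
    [eta_1 + ... + eta_t <= (4/7) t^(1/4)].  Over that distance the gradient grows
    at most by [exp ((4/7) L1^2)] ([grad_growth]), and the initial gradient is
    controlled by [F x1 - Fstar] and [L0] ([enorm_grad_le]).  The early phase
    therefore costs a polynomial in [L1] times [exp ((4/7) L1^2)], which is at
    most a constant times [exp (L1^2)] ([initial_phase_cost]).

    Adding up gives a bound on the sum of [eta_t |grad F x_t|]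
    ([weighted_grad_sum_le]).  In expectation the noise terms contribute
    [eta_t sigma t^(-1/4)], of order [sigma / t], whence one logarithm, and
    dividing by [T eta_T], of order [T^(1/4)], yields the rate. *)

(** * Euclidean geometry of row vectors *)

Definition dotv (R : realType) (d : nat) (u v : 'rV[R]_d) : R :=
  \sum_(i < d) u 0 i * v 0 i.

Section euclidean.
Context (R : realType) (d : nat).
Implicit Types (u v w : 'rV[R]_d) (a : R).

Lemma enorm_ge0 v : 0 <= enorm v.
Proof. exact: sqrtr_ge0. Qed.

Lemma enorm_sqr v : enorm v ^+ 2 = \sum_(i < d) v 0 i ^+ 2.
Proof. by rewrite sqr_sqrtr// sumr_ge0// => i _; exact: sqr_ge0. Qed.

Lemma enormZ a v : enorm (a *: v) = `|a| * enorm v.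
Proof.
rewrite /enorm -sqrtr_sqr -sqrtrM ?sqr_ge0//; congr Num.sqrt.
by rewrite mulr_sumr; apply: eq_bigr => i _; rewrite mxE exprMn.
Qed.

Lemma enormN v : enorm (- v) = enorm v.
Proof. by rewrite -scaleN1r enormZ normrN1 mul1r. Qed.

Lemma enorm0 : enorm (0 : 'rV[R]_d) = 0.
Proof. by rewrite -(scale0r (0 : 'rV[R]_d)) enormZ normr0 mul0r. Qed.

Lemma normr_coord_le_enorm v i : `|v 0 i| <= enorm v.
Proof.
rewrite -sqrtr_sqr ler_wsqrtr// (bigD1 i)//= lerDl sumr_ge0// => j _.
exact: sqr_ge0.
Qed.

Lemma enorm_eq0 v : enorm v = 0 -> v = 0.
Proof.
move=> v0; apply/rowP => i; apply/eqP.
by rewrite mxE -normr_le0 -v0 normr_coord_le_enorm.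
Qed.

Lemma enormDE u v :
  enorm (u + v) ^+ 2 = enorm u ^+ 2 + 2 * dotv u v + enorm v ^+ 2.
Proof.
rewrite !enorm_sqr /dotv mulr_sumr -!big_split/=.
by apply: eq_bigr => i _; rewrite mxE; ring.
Qed.

Lemma dotvZl a u v : dotv (a *: u) v = a * dotv u v.
Proof. by rewrite /dotv mulr_sumr; apply: eq_bigr => i _; rewrite mxE mulrA. Qed.

Lemma dotvC u v : dotv u v = dotv v u.
Proof. by apply: eq_bigr => i _; rewrite mulrC. Qed.

Lemma dotvZr a u v : dotv u (a *: v) = a * dotv u v.
Proof. by rewrite dotvC dotvZl dotvC. Qed.

Lemma dotvDl u v w : dotv (u + v) w = dotv u w + dotv v w.
Proof. by rewrite /dotv -big_split/=; apply: eq_bigr => i _; rewrite mxE mulrDl. Qed.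

Lemma dotvNl u v : dotv (- u) v = - dotv u v.
Proof. by rewrite -scaleN1r dotvZl mulN1r. Qed.

Lemma dotvv u : dotv u u = enorm u ^+ 2.
Proof. by rewrite enorm_sqr; apply: eq_bigr => i _; rewrite expr2. Qed.

Lemma cauchy_schwarz u v : dotv u v <= enorm u * enorm v.
Proof.
have [u0|u0] := eqVneq (enorm u) 0.
  rewrite u0 mul0r (enorm_eq0 u0) /dotv big1// => i _.
  by rewrite mxE mul0r.
have [v0|v0] := eqVneq (enorm v) 0.
  rewrite v0 mulr0 (enorm_eq0 v0) /dotv big1// => i _.
  by rewrite mxE mulr0.
have p : 0 < enorm u * enorm v by rewrite mulr_gt0// lt0r enorm_ge0 ?u0 ?v0.
(* the squared norm of |v| u - |u| v is 2 |u| |v| (|u| |v| - <u, v>) *)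
have := sqr_ge0 (enorm (enorm v *: u + - enorm u *: v)).
rewrite enormDE !enormZ normrN !ger0_norm ?enorm_ge0// dotvZl dotvZr => h.
rewrite -(ler_pM2l p).
nra.
Qed.

Lemma enorm_triangle u v : enorm (u + v) <= enorm u + enorm v.
Proof.
rewrite -(@ler_pXn2r _ 2)// ?nnegrE ?addr_ge0 ?enorm_ge0// enormDE sqrrD.
by have := cauchy_schwarz u v; lra.
Qed.

Lemma enormB_triangle u v w : enorm (u - w) <= enorm (u - v) + enorm (v - w).
Proof. by have := enorm_triangle (u - v) (v - w); rewrite addrA subrK. Qed.

Lemma enormBC u v : enorm (u - v) = enorm (v - u).
Proof. by rewrite -enormN opprB. Qed.

(** Only an inequality: the step vanishes when [v = 0], as [a / 0 = 0]. *)
Lemma enorm_normalized_le a v : 0 <= a -> enorm ((a / enorm v) *: v) <= a.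
Proof.
move=> a0; rewrite enormZ ger0_norm ?divr_ge0 ?enorm_ge0//.
have [->|v0] := eqVneq (enorm v) 0; first by rewrite mulr0.
by rewrite divfK.
Qed.

(** Write [u = v + (u - v)]: the first part contributes [- a |v|], the second at
    most [a |v - u|] by Cauchy-Schwarz, and a second [a |v - u|] is lost in
    passing from [|v|] to [|u|]. *)
Lemma dotv_normalized_le a u v : 0 <= a ->
  dotv u (- ((a / enorm v) *: v)) <= - a * enorm u + 2 * a * enorm (v - u).
Proof.
move=> a0; rewrite -scaleNr dotvZr mulNr.
have [v0|v0] := eqVneq (enorm v) 0.
  rewrite v0 invr0 mulr0 mul0r oppr0 (enorm_eq0 v0) sub0r enormN.
  have := mulr_ge0 a0 (enorm_ge0 u); lra.
have vp : 0 < enorm v by rewrite lt0r v0 enorm_ge0.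
rewrite -[u in dotv u](subrK v) dotvDl dotvv mulrDr.
have -> : a / enorm v * enorm v ^+ 2 = a * enorm v by field.
have h : - (a / enorm v * dotv (u - v) v) <= a * enorm (v - u).
  rewrite -mulrN -dotvNl opprB -mulrA ler_wpM2l// mulrC ler_pdivrMr//.
  exact: cauchy_schwarz.
have := ler_wpM2l a0 (enorm_triangle v (u - v)).
rewrite addrC subrK enormBC mulrDr => h2.
lra.
Qed.

End euclidean.

(** * Gradients and relaxed smoothness *)

Section gradient.
Context (R : realType) (d : nat) (F : 'rV[R]_d -> R).
Hypothesis dF : forall x, differentiable F x.

Lemma derive_dotv_grad x h : 'D_h F x = dotv (grad F x) h.
Proof.
rewrite deriveE// [in LHS](row_sum_delta h) linear_sum /dotv.
by apply: eq_bigr => i _; rewrite linearZ/= mxE deriveE// mulrC.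
Qed.

Lemma mean_value_segment x h : exists2 s : R, 0 <= s <= 1 &
  F (x + h) - F x = dotv (grad F (x + s *: h)) h.
Proof.
pose phi (s : R) := F (x + s *: h).
have dphi (s : R) : is_derive s 1 phi ('D_h F (x + s *: h)).
  have E : (fun r : R => r^-1 *: ((phi \o shift s) (r *: 1) - phi s)) =
           (fun r : R => r^-1 *: ((F \o shift (x + s *: h)) (r *: h) - F (x + s *: h))).
    apply/funext => r; rewrite /phi /=; congr (_ *: (F _ - _)).
    by rewrite scaler1 scalerDl addrCA.
  have dFh : derivable F (x + s *: h) h by exact: diff_derivable.
  by split; [rewrite /derivable E; exact: dFh|rewrite /derive E].
have cphi : {within `[0, 1], continuous phi}.
  apply: continuous_subspaceT => s.
  have [dv _] := dphi s.
  exact: (differentiable_continuous (iffLR (derivable1_diffP phi s) dv)).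
have [s s01] := MVT_segment ler01 (fun s _ => dphi s) cphi.
rewrite /phi scale1r scale0r addr0 subr0 mulr1 derive_dotv_grad => ->.
by exists s.
Qed.

End gradient.

Section smooth.
Context (R : realType) (d : nat) (F : 'rV[R]_d -> R) (L0 L1 : R).
Hypotheses (L00 : 0 <= L0) (L10 : 0 <= L1) (smF : L0L1_smooth L0 L1 F).
Implicit Types (x y h : 'rV[R]_d) (c r : R).

Lemma smoothA1_ge1 c : 0 < c -> 1 <= smoothA1 c.
Proof.
move=> c0; rewrite /smoothA1 ler_pdivlMr// mul1r.
by have := expR_ge1Dx c; lra.
Qed.

Lemma smoothA1_le_expR c : 0 < c -> smoothA1 c <= expR c.
Proof.
move=> c0; rewrite /smoothA1 ler_pdivrMr//.
have := expR_ge1Dx (- c); rewrite expRN => h.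
have e0 := expR_gt0 c.
have : expR c * (1 - c) <= expR c * (expR c)^-1 by rewrite ler_pM2l.
rewrite divff ?gt_eqF//; lra.
Qed.

Lemma smoothA0_le_expR c : 0 < c -> smoothA0 c <= expR c.
Proof.
move=> c0; have := smoothA1_ge1 c0; rewrite /smoothA0 /smoothA1; lra.
Qed.

Lemma expR_quarter_le : expR (4^-1 : R) <= 4 / 3.
Proof.
have := expR_ge1Dx (- 4^-1 : R); rewrite expRN => h.
have e0 := expR_gt0 (4^-1 : R).
have : expR 4^-1 * (1 - 4^-1) <= expR 4^-1 * (expR (4^-1 : R))^-1.
  by rewrite ler_pM2l.
rewrite divff ?gt_eqF//; lra.
Qed.

(** The smoothness condition at the fixed radius [c = 1/4], where both
    [smoothA0 c] and [smoothA1 c] are at most [exp (1/4) <= 4/3]. *)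
Lemma grad_lipschitz_near x y r : enorm (x - y) <= r -> L1 * r <= 4^-1 ->
  enorm (grad F x - grad F y) <= 4 / 3 * (L0 + L1 * enorm (grad F x)) * r.
Proof.
move=> xyr L1r; case: smF => _ sm.
have r0 : 0 <= r by exact: le_trans (enorm_ge0 _) xyr.
have c0 : 0 < 4^-1 :> R by [].
have := sm x y 4^-1 c0 (le_trans (ler_wpM2l L10 xyr) L1r).
have A0 := le_trans (smoothA0_le_expR c0) expR_quarter_le.
have A1 := le_trans (smoothA1_le_expR c0) expR_quarter_le.
move=> /le_trans; apply.
have A1ge0 : 0 <= smoothA1 (4^-1 : R) by exact: le_trans (smoothA1_ge1 c0).
have A0ge0 : 0 <= smoothA0 (4^-1 : R).
  by have := smoothA1_le_expR c0; rewrite /smoothA0 /smoothA1; lra.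
apply: ler_pM => //; rewrite ?enorm_ge0//.
  by rewrite addr_ge0// !mulr_ge0 ?enorm_ge0.
rewrite mulrDr lerD//; first by rewrite ler_wpM2r.
by rewrite mulrA ler_wpM2r ?enorm_ge0// ler_wpM2r.
Qed.

(** With [c = L1 * r], the product [smoothA1 c * (L1 * r)] is [exp (L1 * r) - 1]:
    the gradient grows exponentially in the distance, with rate exactly [L1].
    This rate decides the exponent of the final bound. *)
Lemma grad_growth x y r : enorm (x - y) <= r -> 0 < L1 * r ->
  enorm (grad F y) <= expR (L1 * r) * (enorm (grad F x) + L0 * r).
Proof.
move=> xyr c0; case: smF => _ sm.
have Lx : L1 * enorm (x - y) <= L1 * r by rewrite ler_wpM2l.
have := sm x y _ c0 Lx.
have A0 := smoothA0_le_expR c0; have A1 := smoothA1_ge1 c0.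
have r0 : 0 <= r by exact: le_trans (enorm_ge0 _) xyr.
have gx := enorm_ge0 (grad F x).
rewrite mulrDl => h.
have h0 : smoothA0 (L1 * r) * L0 * enorm (x - y) <= expR (L1 * r) * (L0 * r).
  rewrite mulrA; apply: ler_pM => //; rewrite ?enorm_ge0 ?mulr_ge0//; last first.
    by rewrite ler_wpM2r.
  by have := smoothA1_le_expR c0; rewrite /smoothA0 /smoothA1; lra.
have h1 : smoothA1 (L1 * r) * L1 * enorm (grad F x) * enorm (x - y) <=
    (expR (L1 * r) - 1) * enorm (grad F x).
  rewrite mulrAC ler_wpM2r// -mulrA.
  apply: (@le_trans _ _ (smoothA1 (L1 * r) * (L1 * r))).
    by rewrite ler_wpM2l// (le_trans _ A1).
  by rewrite /smoothA1 divfK ?gt_eqF.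
have := enormB_triangle (grad F y) (grad F x) 0; rewrite !subr0 enormBC.
lra.
Qed.

(** The mean value theorem stands in for the integral remainder; it loses a
    factor two in the quadratic term, which the later constants tolerate. *)
Lemma descent x h r : enorm h <= r -> L1 * r <= 4^-1 ->
  F (x + h) <= F x + dotv (grad F x) h +
    4 / 3 * (L0 + L1 * enorm (grad F x)) * r ^+ 2.
Proof.
move=> hr L1r; case: (smF) => dF _.
have [s /andP[s0 s1] E] := mean_value_segment dF x h.
have r0 : 0 <= r by exact: le_trans (enorm_ge0 _) hr.
have sh : enorm (x - (x + s *: h)) <= r.
  rewrite opprD addrA subrr sub0r enormN enormZ ger0_norm//.
  by rewrite (le_trans _ hr)// ler_piMl ?enorm_ge0.
have := grad_lipschitz_near sh L1r; rewrite enormBC => g.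
have : dotv (grad F (x + s *: h) - grad F x) h <=
    4 / 3 * (L0 + L1 * enorm (grad F x)) * r ^+ 2.
  apply: (le_trans (cauchy_schwarz _ _)).
  by rewrite expr2 mulrA ler_pM ?enorm_ge0.
rewrite dotvDl dotvNl; lra.
Qed.

(** A step of length [r = 1 / (4 (1 + L1))] against the gradient lowers [F] by at
    least [(2/3) r |grad F x| - (4/3) L0 r^2], but never below [Fstar]. *)
Lemma enorm_grad_le x Fstar : (forall y, Fstar <= F y) ->
  enorm (grad F x) <= 6 * (1 + L1) * (F x - Fstar) + L0.
Proof.
move=> Fge.
have L1p : 0 < 1 + L1 by rewrite ltr_wpDr.
pose r : R := (4 * (1 + L1))^-1.
have r0 : 0 < r by rewrite invr_gt0 mulr_gt0.
have L1r : L1 * r <= 4^-1.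
  by rewrite /r invfM mulrCA ler_piMr// ler_pdivrMr// mul1r lerDr.
have rl : (1 + L1) * r = 4^-1 by rewrite /r invfM mulrCA divff ?mulr1// gt_eqF.
clearbody r; set e := enorm (grad F x); have e0 : 0 <= e by exact: enorm_ge0.
have hn : enorm (- ((r / e) *: grad F x)) <= r.
  by rewrite enormN enorm_normalized_le// ltW.
have := descent x hn L1r.
have := dotv_normalized_le (grad F x) (grad F x) (ltW r0).
rewrite subrr enorm0 mulr0 addr0 -/e => h1 h2.
have h3 := Fge (x - ((r / e) *: grad F x)).
have h4 : r * e - 4 / 3 * (L0 + L1 * e) * r ^+ 2 <= F x - Fstar by lra.
have h5 : L1 * r * (e * r) <= 4^-1 * (e * r).
  by rewrite ler_wpM2r// mulr_ge0// ltW.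
have h6 : r * (2 / 3 * e) <= r * (4 * (1 + L1) * (F x - Fstar) + 4 / 3 * L0 * r).
  have -> : r * (4 * (1 + L1) * (F x - Fstar) + 4 / 3 * L0 * r) =
     4 * ((1 + L1) * r) * (F x - Fstar) + 4 / 3 * L0 * r ^+ 2 by ring.
  rewrite rl divff// mul1r; lra.
rewrite ler_pM2l// in h6.
have h7 : L0 * r <= L0 * 4^-1.
  rewrite ler_wpM2l// -rl ler_pMl// lerDl//.
have := L00; lra.
Qed.

End smooth.

(** * Borel measurability in dimension d *)

Lemma continuous_borel_rV_measurable (R : realType) d (f : 'rV[R]_d -> R) :
  continuous f -> measurable_fun [set: borel_rV R d] f.
Proof.
move=> cf; apply: (measurability _ (RGenOpens.measurableE R)).
move=> _ [_ [a [b ->]] <-]; rewrite setTI; apply: sub_sigma_algebra.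
by apply: open_comp => // x _; exact: cf.
Qed.

Lemma measurable_borel_rV_coord (R : realType) d (i : 'I_d) :
  measurable_fun [set: borel_rV R d] (fun v : 'rV[R]_d => v 0 i).
Proof.
by apply: continuous_borel_rV_measurable => x; exact: coord_continuous.
Qed.

(** Second countability: it makes the Borel sets of R^d generated by the
    coordinates. *)
Lemma open_rV_bigcup_rat (R : realType) d (U : set 'rV[R]_d) : open U ->
  U = \bigcup_(p in [set p : 'rV[rat]_d * nat |
          ball (map_mx ratr p.1 : 'rV[R]_d) p.2.+1%:R^-1 `<=` U])
        ball (map_mx ratr p.1 : 'rV[R]_d) p.2.+1%:R^-1.
Proof.
move=> oU; apply/seteqP; split => [x Ux|x [p pU]]; last exact: pU.
have /nbhs_ballP[e /= e0 eU] : nbhs x U by exact: open_nbhs_nbhs.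
have [n ne] : exists n, n.+1%:R^-1 < e / 2.
  have [n] := ltr_add_invr (y := 0) (x := e / 2) (divr_gt0 e0 (ltr0Sn _ _)).
  by rewrite add0r; exists n.
have n0 : 0 < n.+1%:R^-1 :> R by rewrite invr_gt0.
have {}/choice[c cP] : forall i, exists c : rat, `|x 0 i - ratr c| < n.+1%:R^-1.
  move=> i; have /rat_in_itvoo[c] : x 0 i - n.+1%:R^-1 < x 0 i + n.+1%:R^-1.
    by rewrite ltrD2l gtrN.
  by rewrite in_itv/= => /andP[h1 h2]; exists c; rewrite ltr_distlC h1 h2.
have bx : ball (map_mx ratr (\row_i c i) : 'rV[R]_d) n.+1%:R^-1 x.
  split => // i j; rewrite !mxE (ord1 i).
  by rewrite /ball/= distrC; exact: cP.
exists (\row_i c i, n) => //= y; rewrite /= => by_; apply: eU.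
apply: (@le_ball _ _ _ (n.+1%:R^-1 + n.+1%:R^-1)).
  by rewrite [leRHS]splitr lerD// ltW.
by apply: ball_triangle by_; apply: ball_sym.
Qed.

(** Measurability of vector operations can thus be checked on coordinates, which
    avoids comparing the Borel sets of a product with products of Borel sets. *)
Lemma measurable_fun_borel_rV (R : realType) d disp (T : measurableType disp)
    (f : T -> 'rV[R]_d) :
  (forall i, measurable_fun setT (fun t => f t 0 i)) ->
  measurable_fun setT (f : T -> borel_rV R d).
Proof.
move=> mf; apply: (@measurability _ _ T (borel_rV R d) setT f (@open _)) => //.
move=> _ [U oU <-]; rewrite setTI (open_rV_bigcup_rat oU) preimage_bigcup.
rewrite bigcup_mkcond.
apply: countable_bigcupT_measurable => // -[c n]; case: ifPn => // _.
rewrite [X in measurable X](_ : _ =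
  \bigcap_(i in [set: 'I_d])
     ((fun t => f t 0 i) @^-1` @ball _ R (ratr (c 0 i)) n.+1%:R^-1)).
  apply: fin_bigcap_measurable => // i _.
  rewrite -[X in measurable X]setTI; apply: mf => //.
  by apply: open_measurable; apply: ball_open; rewrite invr_gt0.
apply/seteqP; split => [t [_ tb] i _|t tb]; first by have := tb 0 i; rewrite !mxE.
split => [|i j]; first by rewrite invr_gt0.
by rewrite (ord1 i) mxE; exact: tb.
Qed.
Section measurable_rV.
Context (R : realType) (d : nat) (disp : measure_display)
  (T : measurableType disp).
Implicit Types f h : T -> borel_rV R d.

Lemma measurable_rV_coord f i : measurable_fun setT f ->
  measurable_fun setT (fun t => (f t : 'rV[R]_d) 0 i).
Proof. exact: (measurableT_comp (measurable_borel_rV_coord i)). Qed.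

Lemma measurable_enorm f : measurable_fun setT f ->
  measurable_fun setT (fun t => enorm (f t : 'rV[R]_d)).
Proof.
move=> mf; rewrite /enorm.
apply: (measurableT_comp (f := @Num.sqrt R)).
  by apply: continuous_measurable_fun; exact: sqrt_continuous.
by apply: measurable_sum => i; apply: measurable_funX; exact: measurable_rV_coord.
Qed.

Lemma measurable_enormV f : measurable_fun setT f ->
  measurable_fun setT (fun t => (enorm (f t : 'rV[R]_d))^-1).
Proof.
move=> mf; rewrite (_ : (fun _ => _) = (fun t => enorm (f t : 'rV[R]_d) `^ (-1))).
  exact: (measurableT_comp (measurable_powR (-1)) (measurable_enorm mf)).
by apply/funext => t; rewrite powR_inv1 ?enorm_ge0.
Qed.

Lemma measurable_rVD f h : measurable_fun setT f -> measurable_fun setT h ->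
  measurable_fun setT (fun t => (f t : 'rV[R]_d) + (h t : 'rV[R]_d) : borel_rV R d).
Proof.
move=> mf mh; apply: measurable_fun_borel_rV => i.
under eq_fun do rewrite mxE.
by apply: measurable_funD; exact: measurable_rV_coord.
Qed.

Lemma measurable_rVZ (a : T -> R) f : measurable_fun setT a ->
  measurable_fun setT f ->
  measurable_fun setT (fun t => a t *: (f t : 'rV[R]_d) : borel_rV R d).
Proof.
move=> ma mf; apply: measurable_fun_borel_rV => i.
under eq_fun do rewrite mxE.
by apply: measurable_funM => //; exact: measurable_rV_coord.
Qed.

Lemma measurable_rVB f h : measurable_fun setT f -> measurable_fun setT h ->
  measurable_fun setT (fun t => (f t : 'rV[R]_d) - (h t : 'rV[R]_d) : borel_rV R d).
Proof.
move=> mf mh; apply: measurable_fun_borel_rV => i.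
under eq_fun do rewrite !mxE.
by apply: measurable_funB; exact: measurable_rV_coord.
Qed.

End measurable_rV.

Lemma near_enorm_le (R : realType) d (x : 'rV[R]_d) (e : R) : 0 < e ->
  \forall y \near x, enorm (x - y) <= e.
Proof.
move=> e0; apply/nbhs_ballP; have e'0 : 0 < e / d.+1%:R by exact: divr_gt0.
exists (e / d.+1%:R) => //= y [_ xy].
rewrite -(@ler_pXn2r _ 2)// ?nnegrE ?enorm_ge0 ?(ltW e0)// enorm_sqr.
apply: (@le_trans _ _ (\sum_(i < d) (e / d.+1%:R) ^+ 2)).
  apply: ler_sum => i _.
  rewrite -real_normK ?num_real// ler_pXn2r// ?nnegrE ?normr_ge0 ?(ltW e'0)//.
  by rewrite !mxE ltW//; exact: xy.
rewrite sumr_const card_ord -[leLHS]mulr_natr expr_div_n -mulrA ler_piMr ?sqr_ge0//.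
rewrite ler_pdivrMl ?exprn_gt0// mulr1 -natrX ler_nat.
by rewrite (leq_trans (leqnSn d))// -[X in (X <= _)%N]muln1 leq_mul.
Qed.

(** The smoothness condition makes the gradient locally Lipschitz at each point,
    hence continuous. *)
Lemma measurable_grad (R : realType) d (F : 'rV[R]_d -> R) (L0 L1 : R) :
  0 <= L0 -> 0 <= L1 -> L0L1_smooth L0 L1 F ->
  measurable_fun [set: borel_rV R d] (grad F : borel_rV R d -> borel_rV R d).
Proof.
move=> L00 L10 smF; apply: measurable_fun_borel_rV => i.
apply: continuous_borel_rV_measurable => x.
set K := 4 / 3 * (L0 + L1 * enorm (grad F x)).
have K0 : 0 <= K by rewrite mulr_ge0// addr_ge0// mulr_ge0// enorm_ge0.
apply/(@cvgrPdist_le _ _ _ (nbhs (x : 'rV[R]_d))) => e e0.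
have r1 : 0 < e / (1 + K) by rewrite divr_gt0// ltr_wpDr.
have r2 : 0 < (4 * (1 + L1))^-1 by rewrite invr_gt0 mulr_gt0// ltr_wpDr.
near=> y.
have xy1 : enorm (x - y) <= e / (1 + K) by near: y; exact: near_enorm_le.
have xy2 : enorm (x - y) <= (4 * (1 + L1))^-1 by near: y; exact: near_enorm_le.
have := normr_coord_le_enorm (grad F x - grad F y) i.
rewrite [in X in X -> _]mxE [(- _ : matrix _ _ _) _ _]mxE => /le_trans; apply.
have L1xy : L1 * enorm (x - y) <= 4^-1.
  apply: (le_trans (ler_wpM2l L10 xy2)).
  by rewrite invfM mulrCA ler_piMr// ler_pdivrMr ?mul1r ?lerDr// ltr_wpDr.
apply: (le_trans (grad_lipschitz_near L00 L10 smF (lexx _) L1xy)).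
rewrite -/K; apply: (le_trans (ler_wpM2l K0 xy1)).
by rewrite mulrCA ler_piMr ?(ltW e0)// ler_pdivrMr ?mul1r ?lerDr// ltr_wpDr.
Unshelve. all: by end_near. Qed.

(** * Recursions driven by independent inputs *)

(** Both sides are finite measures in [A], so it is enough to compare them on a
    generating pi-system. *)
Lemma pi_system_indep (R : realType) disp disp' (Omega : measurableType disp)
    (T : measurableType disp') (P : probability Omega R) (Z : {RV P >-> T})
    (E : set Omega) (G : set (set T)) :
  measurable E -> @measurable _ T = <<s G >> -> setI_closed G -> G setT ->
  (forall A, G A -> P (Z @^-1` A `&` E) = (P (Z @^-1` A) * P E)%E) ->
  forall A, measurable A -> P (Z @^-1` A `&` E) = (P (Z @^-1` A) * P E)%E.
Proof.
move=> mE GE GI GT GP A mA.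
have PEfin : P E \is a fin_num by exact: fin_num_measure.
have PE0 : 0 <= fine (P E) by exact: fine_ge0.
pose mu1 : {measure set T -> \bar R} := pushforward (mrestr P mE) Z.
have mZ : measurable_fun [set: Omega] Z by [].
pose mu2 := mscale (NngNum PE0) (distribution P Z).
rewrite muleC -(fineK PEfin).
have mG B : G B -> measurable B by move=> GB; rewrite GE; exact: sub_sigma_algebra.
apply: (@measure_unique _ R T G (fun=> setT) GE GI _ _ (mu1 mZ) mu2) => //.
- by rewrite bigcup_const.
- move=> B GB; rewrite [LHS]GP// muleC -[X in (X * _)%E](fineK PEfin).
  exact: erefl.
- move=> _; rewrite /mu1/= /pushforward/= /mrestr setIC setIT.
  by rewrite ltey_eq fin_num_measure.
Qed.

Section driven_recursion.
Context (R : realType) (disp disp' dispS : measure_display)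
  (Omega : measurableType disp) (Xi : measurableType disp')
  (S : measurableType dispS) (P : probability Omega R).
Variables (Phi : nat -> S -> Xi -> S) (s0 : S) (xis : nat -> {RV P >-> Xi}).
Hypothesis mPhi : forall n, measurable_fun [set: S * Xi] (fun p => Phi n p.1 p.2).
Hypothesis xis_indep : mutually_independent [set t | (1 <= t)%N] xis.

Fixpoint driven (n : nat) (w : Omega) : S :=
  if n is n'.+1 then Phi n (driven n' w) (xis n w) else s0.

Lemma measurable_driven n : measurable_fun [set: Omega] (driven n).
Proof.
elim: n => [|n IHn] /=; first exact: measurable_cst.
have mxi : measurable_fun setT (xis n.+1) by [].
exact: (measurableT_comp (mPhi n.+1) (measurable_fun_pair IHn mxi)).
Qed.

Definition driven_rv n : {RV P >-> S} := mfun_Sub (mem_set (measurable_driven n)).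

(** Independence from every finite family of future inputs, and not only from the
    next one, is what the induction needs: going from [n] to [n.+1] consumes the
    input [n.+1], which is therefore added to the family.  Rectangles of [S * Xi]
    are the pi-system on which the pair of the old state and the new input is
    tested. *)
Lemma driven_indep_future n (J : {fset nat}) (A : set S) (B : nat -> set Xi) :
  (forall t, t \in J -> (n < t)%N) -> measurable A ->
  (forall t, measurable (B t)) ->
  (P (driven n @^-1` A `&` \bigcap_(t in [set` J]) (xis t @^-1` B t)) =
   P (driven n @^-1` A) * P (\bigcap_(t in [set` J]) (xis t @^-1` B t)))%E.
Proof.
elim: n J A B => [|n IHn] J A B Jn mA mB.
  have [sA|sA] := pselect (A s0).
    rewrite (_ : driven 0 @^-1` A = setT); last by apply/seteqP; split.
    by rewrite setTI probability_setT mul1e.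
  rewrite (_ : driven 0 @^-1` A = set0); last by apply/seteqP; split.
  by rewrite set0I measure0 mul0e.
have mE : measurable (\bigcap_(t in [set` J]) (xis t @^-1` B t)).
  by apply: fin_bigcap_measurable => // t _; exact: measurable_funPTI.
set E := (X in measurable X) in mE *.
have mZ : measurable_fun [set: Omega] (fun w => (driven n w, xis n.+1 w)).
  exact: measurable_fun_pair (measurable_driven n) _.
pose Z : {RV P >-> (S * Xi)%type} := mfun_Sub (mem_set mZ).
have ZE w : Z w = (driven n w, xis n.+1 w) by [].
pose C := (fun p : S * Xi => Phi n.+1 p.1 p.2) @^-1` A.
have mC : measurable C by rewrite -[C]setTI; exact: mPhi.
have -> : driven n.+1 @^-1` A = Z @^-1` C by [].
apply: (pi_system_indep mE (measurable_prod_measurableType S Xi)) => //.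
- move=> _ _ [A1 mA1 [B1 mB1 <-]] [A2 mA2 [B2 mB2 <-]].
  rewrite -setXI; exists (A1 `&` A2); first exact: measurableI.
  by exists (B1 `&` B2) => //; exact: measurableI.
- by exists setT => //; exists setT => //; rewrite setXTT.
move=> _ [A1 mA1 [B1 mB1 <-]].
have n1J : n.+1 \notin J by apply/negP => /Jn; rewrite ltnn.
pose B' t := if t == n.+1 then B1 else B t.
have mB' t : measurable (B' t) by rewrite /B'; case: ifP.
have EB' : E = \bigcap_(t in [set` J]) (xis t @^-1` B' t).
  apply: eq_bigcapr => t tJ; rewrite /B'; case: eqP => // tn.
  by move: n1J; rewrite -tn; case/negP.
have cap1 : \bigcap_(t in [set` (n.+1 |` J)%fset]) (xis t @^-1` B' t) =
    xis n.+1 @^-1` B1 `&` E.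
  rewrite EB'; apply/seteqP; split => [w h|w [h1 h2] t /=].
    split; first by have := h n.+1; rewrite /B' eqxx; apply; rewrite /= fset1U1.
    by move=> t /= tJ; apply: h; rewrite /= fset1Ur.
  rewrite /= in_fset1U => /orP[/eqP ->|]; first by rewrite /B' eqxx.
  exact: h2.
have ZX : Z @^-1` (A1 `*` B1) = driven n @^-1` A1 `&` xis n.+1 @^-1` B1 by [].
have Jlt t : t \in (n.+1 |` J)%fset -> (n < t)%N.
  by rewrite in_fset1U => /orP[/eqP ->//|/Jn /ltnW].
have cap0 : \bigcap_(t in [set` [fset n.+1]%fset]) (xis t @^-1` B' t) =
    xis n.+1 @^-1` B1.
  apply/seteqP; split => [w /(_ n.+1)|w h t /=]; rewrite /B'/=.
    by rewrite eqxx; apply; rewrite inE.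
  by rewrite inE => /eqP ->; rewrite eqxx.
have P2 : P (Z @^-1` (A1 `*` B1)) =
    (P (driven n @^-1` A1) * P (xis n.+1 @^-1` B1))%E.
  rewrite ZX -cap0 IHn// => t; rewrite inE => /eqP -> //.
have P1 : P (xis n.+1 @^-1` B1 `&` E) = (P (xis n.+1 @^-1` B1) * P E)%E.
  rewrite -cap1 xis_indep//; last first.
    by move=> t /= /Jlt; exact: leq_trans.
  rewrite big_fsetU1//= /B' eqxx -/(B' _) EB' xis_indep//.
  by move=> t /= /Jn; exact: leq_trans.
by rewrite P2 ZX -setIA -cap1 IHn// cap1 P1 muleA.
Qed.

Lemma law_driven_input n (C : set (S * Xi)) : measurable C ->
  ((distribution P (driven_rv n) \x distribution P (xis n.+1)) C =
   P ((fun w => (driven n w, xis n.+1 w)) @^-1` C))%E.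
Proof.
have mZ : measurable_fun [set: Omega] (fun w => (driven n w, xis n.+1 w)).
  exact: measurable_fun_pair (measurable_driven n) _.
pose Z : {RV P >-> (S * Xi)%type} := mfun_Sub (mem_set mZ).
move=> mC; rewrite (product_measure_unique (m' := distribution P Z))//.
move=> A B mA mB; rewrite /distribution /pushforward/=.
have cap0 : \bigcap_(t in [set` [fset n.+1]%fset]) (xis t @^-1` B) =
    xis n.+1 @^-1` B.
  apply/seteqP; split => [w /(_ n.+1)/=|w h t /=].
    by apply; rewrite inE.
  by rewrite inE => /eqP ->.
have := @driven_indep_future n [fset n.+1]%fset A (fun=> B).
rewrite cap0 => <-//.
by move=> t; rewrite inE => /eqP ->.
Qed.

End driven_recursion.

Section driven_expectation.
Local Open Scope ereal_scope.
Context (R : realType) (disp disp' dispS : measure_display)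
  (Omega : measurableType disp) (Xi : measurableType disp')
  (S : measurableType dispS) (P : probability Omega R).
Variables (Phi : nat -> S -> Xi -> S) (s0 : S) (xis : nat -> {RV P >-> Xi}).
Hypothesis mPhi : forall n, measurable_fun [set: S * Xi] (fun p => Phi n p.1 p.2).
Hypothesis xis_indep : mutually_independent [set t | (1 <= t)%N] xis.

Lemma measurable_integral_input (xi : {RV P >-> Xi}) (h : S * Xi -> \bar R) :
  measurable_fun setT h -> (forall p, 0 <= h p) ->
  measurable_fun setT (fun s => \int[P]_w h (s, xi w)).
Proof.
move=> mh h0; rewrite (_ : (fun s => _) = fubini_F (distribution P xi) h).
  exact: measurable_fun_fubini_tonelli_F.
apply/funext => s; rewrite /fubini_F ge0_integral_distribution//.
by apply: measurableT_comp mh _; exact: measurable_fun_pair.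
Qed.

(** Conditioning on the current state: the next input can be replaced by an
    independent copy, which is integrated out first.  Since [h] is nonnegative,
    this is Tonelli's theorem and needs no integrability. *)
Lemma integral_driven_input (xi : {RV P >-> Xi}) n (h : S * Xi -> \bar R) :
  (forall A, measurable A ->
     distribution P (xis n.+1) A = distribution P xi A) ->
  measurable_fun setT h -> (forall p, 0 <= h p) ->
  \int[P]_w h (driven Phi s0 xis n w, xis n.+1 w) =
  \int[P]_w \int[P]_w' h (driven Phi s0 xis n w, xi w').
Proof.
move=> Exi mh h0.
have mY : measurable_fun setT (driven Phi s0 xis n) by exact: measurable_driven.
have mZ : measurable_fun [set: Omega]
    (fun w => (driven Phi s0 xis n w, xis n.+1 w)).
  exact: measurable_fun_pair mY _.
pose Z : {RV P >-> (S * Xi)%type} := mfun_Sub (mem_set mZ).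
pose Y := driven_rv s0 xis mPhi n.
have mh2 s : measurable_fun setT (fun z => h (s, z)).
  by apply: measurableT_comp mh _; exact: measurable_fun_pair.
have -> : \int[P]_w h (driven Phi s0 xis n w, xis n.+1 w) =
    \int[distribution P Z]_p h p.
  by rewrite ge0_integral_distribution.
rewrite (eq_measure_integral
  (distribution P Y \x distribution P (xis n.+1))); last first.
  by move=> C mC _; symmetry; exact: law_driven_input.
rewrite fubini_tonelli1//.
transitivity (\int[distribution P Y]_s \int[P]_w' h (s, xi w')).
  apply: eq_integral => s _; rewrite /fubini_F.
  rewrite (eq_measure_integral (distribution P xi)); last by move=> A mA _; exact: Exi.
  by rewrite ge0_integral_distribution.
rewrite ge0_integral_distribution//; first exact: measurable_integral_input.
by move=> s; exact: integral_ge0.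
Qed.

End driven_expectation.

(** * Moments of random vectors *)

Section second_moment.
Context (R : realType) (d : nat) (disp : measure_display)
  (Omega : measurableType disp) (P : probability Omega R).

Lemma integral_probability_cst (r : \bar R) : (\int[P]__ r = r)%E.
Proof.
rewrite integral_cst// -[RHS]mule1; congr (_ * _)%E.
exact: probability_setT.
Qed.

(** The cross term is a linear form in the centred vector [v], hence has integral
    zero; [u] is deterministic because the current state is frozen when the next
    sample is integrated out. *)
Lemma second_moment_affine (v : Omega -> 'rV[R]_d) (u : 'rV[R]_d) (a b s : R) :
  (forall i, P.-integrable setT (fun w => (v w 0 i)%:E) /\
             (\int[P]_w (v w 0 i)%:E = 0)%E) ->
  (\int[P]_w (enorm (v w) ^+ 2)%:E <= (s ^+ 2)%:E)%E ->
  (\int[P]_w (enorm (a *: u + b *: v w) ^+ 2)%:E <=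
     (a ^+ 2 * enorm u ^+ 2 + b ^+ 2 * s ^+ 2)%:E)%E.
Proof.
move=> v0 v2.
have mv i : measurable_fun setT (fun w => v w 0 i).
  by have [/measurable_int/measurable_EFinP] := v0 i.
have iv2 : P.-integrable setT (fun w => (enorm (v w) ^+ 2)%:E).
  apply/integrableP; split.
    apply/measurable_EFinP; under eq_fun do rewrite enorm_sqr.
    by apply: measurable_sum => i; exact: measurable_funX.
  apply: le_lt_trans (ltry (s ^+ 2)); apply: le_trans v2.
  rewrite le_eqVlt; apply/orP; left; apply/eqP; apply: eq_integral => w _.
  by rewrite gee0_abs// lee_fin sqr_ge0.
have iu : P.-integrable setT (fun w => \sum_(i < d) ((u 0 i)%:E * (v w 0 i)%:E))%E.
  by apply: integrable_sum => // i _; apply: integrableZl => //; case: (v0 i).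
have Iu : (\int[P]_w \sum_(i < d) ((u 0 i)%:E * (v w 0 i)%:E) = 0)%E.
  rewrite integral_sum//; last by move=> i; apply: integrableZl => //; case: (v0 i).
  by rewrite big1// => i _; have [? E] := v0 i; rewrite integralZl// E mule0.
have -> : (fun w => (enorm (a *: u + b *: v w) ^+ 2)%:E) = (fun w =>
    (a ^+ 2 * enorm u ^+ 2)%:E + ((2 * a * b)%:E *
      (\sum_(i < d) ((u 0 i)%:E * (v w 0 i)%:E)) +
    (b ^+ 2)%:E * (enorm (v w) ^+ 2)%:E))%E.
  apply/funext => w.
  rewrite enormDE dotvZl dotvZr !enormZ !exprMn !real_normK ?num_real//.
  under eq_bigr do rewrite -EFinM.
  by rewrite sumEFin -!EFinM -!EFinD; congr EFin; rewrite /dotv; ring.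
rewrite integralD//=; last 2 first.
- exact: finite_measure_integrable_cst.
- by apply: integrableD => //; exact: integrableZl.
rewrite integralD//=; [|exact: integrableZl|exact: integrableZl].
rewrite !integralZl// Iu mule0 add0e integral_probability_cst.
by rewrite EFinD leeD2l// [leRHS]EFinM lee_wpmul2l// lee_fin sqr_ge0.
Qed.

Lemma first_moment_le (f : Omega -> R) (s : R) :
  0 <= s -> measurable_fun setT f -> (forall w, 0 <= f w) ->
  (\int[P]_w (f w ^+ 2)%:E <= (s ^+ 2)%:E)%E ->
  (\int[P]_w (f w)%:E <= s%:E)%E.
Proof.
move=> s0 mf f0 f2; apply/lee_addgt0Pr => e e0.
have l0 : 0 < s + e by rewrite ltr_wpDl.
(* f <= (l + f^2 / l) / 2 at l = s + e, which also covers s = 0 *)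
apply: (@le_trans _ _ (\int[P]_w (((s + e) / 2)%:E +
    ((2 * (s + e))^-1)%:E * (f w ^+ 2)%:E))%E).
  apply: ge0_le_integral => //.
  - by move=> w _; rewrite lee_fin.
  - exact/measurable_EFinP.
  - apply: emeasurable_funD => //; apply: emeasurable_funM => //.
    by apply/measurable_EFinP; exact: measurable_funX.
  - move=> w _; rewrite -EFinM -EFinD lee_fin -subr_ge0.
    have -> : (s + e) / 2 + (2 * (s + e))^-1 * f w ^+ 2 - f w =
        (2 * (s + e))^-1 * (s + e - f w) ^+ 2 by field; rewrite gt_eqF.
    by rewrite mulr_ge0 ?sqr_ge0// invr_ge0 mulr_ge0// ltW.
rewrite ge0_integralD//; last 3 first.
- by move=> w _; rewrite lee_fin divr_ge0// ltW.
- by move=> w _; rewrite -EFinM lee_fin mulr_ge0 ?sqr_ge0// invr_ge0 mulr_ge0// ltW.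
- apply: emeasurable_funM => //.
  by apply/measurable_EFinP; exact: measurable_funX.
rewrite ge0_integralZl//; last 3 first.
- by apply/measurable_EFinP; exact: measurable_funX.
- by move=> w _; rewrite lee_fin sqr_ge0.
- by rewrite lee_fin invr_ge0 mulr_ge0// ltW.
rewrite integral_probability_cst.
apply: (@le_trans _ _ (((s + e) / 2)%:E + ((2 * (s + e))^-1)%:E * (s ^+ 2)%:E)%E).
  by rewrite leeD2l// lee_wpmul2l// lee_fin invr_ge0 mulr_ge0// ltW.
rewrite -EFinM -!EFinD lee_fin.
have : (2 * (s + e))^-1 * s ^+ 2 <= (2 * (s + e))^-1 * (s + e) ^+ 2.
  rewrite ler_wpM2l ?invr_ge0 ?mulr_ge0 ?(ltW l0)//.
  by rewrite ler_pXn2r// ?nnegrE ?(ltW l0)// lerDl ltW.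
have -> : (2 * (s + e))^-1 * (s + e) ^+ 2 = (s + e) / 2 by field; rewrite gt_eqF.
lra.
Qed.

End second_moment.

(** * The time scale of the parameters *)

Section quartic_root.
Context (R : realType).
Implicit Types n : nat.

(** The schedules are [eta_t = t^(-3/4) / 7] and [beta_t = 1 - t^(-1/2)], so that
    [t^(1/4)] and its integer powers express all the rates. *)
Definition qroot n : R := n%:R `^ (1 / 4).

Lemma qroot_ge0 n : 0 <= qroot n. Proof. exact: powR_ge0. Qed.

Lemma qroot_exp4 n : qroot n ^+ 4 = n%:R.
Proof. by rewrite -powR_mulrn ?qroot_ge0// -powRrM divfK// powRr1. Qed.

Lemma qroot_gt0 n : 0 < qroot n.+1. Proof. by rewrite powR_gt0. Qed.

Lemma qroot_ge1 n : 1 <= qroot n.+1.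
Proof.
rewrite -(@ler_pXn2r _ 4)// ?nnegrE ?qroot_ge0//.
by rewrite qroot_exp4 expr1n ler1n.
Qed.

Lemma qroot_le m n : (m <= n)%N -> qroot m <= qroot n.
Proof.
move=> mn; rewrite -(@ler_pXn2r _ 4)// ?nnegrE ?qroot_ge0//.
by rewrite !qroot_exp4 ler_nat.
Qed.

Lemma qroot0 : qroot 0 = 0.
Proof. by rewrite /qroot powR0// gt_eqF// divr_gt0. Qed.

Lemma eta_schedE n : eta_sched R n = (qroot n ^+ 3)^-1 / 7.
Proof.
rewrite /eta_sched powRN -powR_mulrn ?qroot_ge0// -powRrM.
by congr ((_ `^ _)^-1 / 7); field.
Qed.

Lemma beta_schedE n : beta_sched R n = 1 - (qroot n ^+ 2)^-1.
Proof.
rewrite /beta_sched powRN -powR_mulrn ?qroot_ge0// -powRrM.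
by congr (1 - (_ `^ _)^-1); field.
Qed.

Lemma qroot_sqr_step n : qroot n.+1 ^+ 2 <= qroot n ^+ 2 + 1.
Proof.
rewrite -(@ler_pXn2r _ 2)// ?nnegrE ?addr_ge0 ?sqr_ge0//.
rewrite -exprM qroot_exp4 sqrrD expr1n mulr1 -exprM qroot_exp4 -natr1.
by rewrite lerD2r lerDl mulrn_wge0// sqr_ge0.
Qed.

(** With [a = t^(-1/2)] and [s = (t - 1)^(-1/2)], the inequality
    [(1 - a)^2 s + a^2 <= a] reduces to [(1 - a) s <= a], that is to
    [t^(1/2) <= (t - 1)^(1/2) + 1].  At [t = 1], [s] is [0^-1 = 0]. *)
Lemma qroot_variance_step n :
  (1 - (qroot n.+1 ^+ 2)^-1) ^+ 2 * (qroot n ^+ 2)^-1 +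
  (qroot n.+1 ^+ 2)^-1 ^+ 2 <= (qroot n.+1 ^+ 2)^-1.
Proof.
have p1 := qroot_ge1 n.
have p0 : 0 < qroot n.+1 ^+ 2 by rewrite exprn_gt0// qroot_gt0.
have := qroot_sqr_step n.
set a := (qroot n.+1 ^+ 2)^-1 => step.
have a0 : 0 < a by rewrite invr_gt0.
have a1 : a <= 1 by rewrite invf_le1// exprn_ege1.
have as_ : (1 - a) * (qroot n ^+ 2)^-1 <= a.
  have [r0|r0] := eqVneq (qroot n ^+ 2) 0.
    by rewrite r0 invr0 mulr0 ltW.
  have rp : 0 < qroot n ^+ 2 by rewrite lt0r r0 sqr_ge0.
  rewrite ler_pdivrMr// -(ler_pM2l p0) mulrBr mulr1 mulrA.
  rewrite divff ?gt_eqF// mul1r; lra.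
have := ler_wpM2l (_ : 0 <= 1 - a) as_; rewrite subr_ge0 => /(_ a1) h.
rewrite expr2 -mulrA.
apply: (@le_trans _ _ ((1 - a) * a + a ^+ 2)); first by rewrite lerD2r.
by rewrite expr2 -mulrDl subrK mul1r.
Qed.

Let eta n := eta_sched R n.+1.

Lemma eta_gt0 n : 0 < eta n.
Proof. by rewrite /eta eta_schedE divr_gt0// invr_gt0 exprn_gt0// qroot_gt0. Qed.

(** Consecutive fourth roots [r <= p] satisfy [1 = p^4 - r^4 <= 4 p^3 (p - r)], so
    the sum is dominated by a telescoping one. *)
Lemma sum_eta_le n : \sum_(i < n) eta i <= 4 / 7 * qroot n.
Proof.
elim: n => [|n IHn]; first by rewrite big_ord0 qroot0 mulr0.
rewrite big_ord_recr/=; apply: (le_trans (lerD IHn (lexx _))).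
rewrite /eta eta_schedE; have p0 := qroot_gt0 n.
have r0 := qroot_ge0 n; have rp := qroot_le (leqnSn n).
have E : qroot n.+1 ^+ 4 = qroot n ^+ 4 + 1 by rewrite !qroot_exp4 natr1.
move: p0 r0 rp E; set p := qroot n.+1; set r := qroot n => p0 r0 rp E.
have p3 : 0 < p ^+ 3 by rewrite exprn_gt0.
suff : (p ^+ 3)^-1 <= 4 * (p - r) by lra.
rewrite -[(p ^+ 3)^-1]mul1r ler_pdivrMr//.
have h : (p - r) * (p ^+ 3 + p ^+ 2 * r + p * r ^+ 2 + r ^+ 3) = 1.
  have -> : 1 = p ^+ 4 - r ^+ 4 by rewrite E; ring.
  ring.
rewrite -[leLHS]h (_ : 4 * (p - r) * p ^+ 3 = (p - r) * (4 * p ^+ 3)); last by ring.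
rewrite ler_wpM2l ?subr_ge0//.
have h1 : p ^+ 2 * r <= p ^+ 2 * p by rewrite ler_wpM2l// sqr_ge0.
have h2 : p * r ^+ 2 <= p * p ^+ 2.
  by rewrite ler_wpM2l ?(ltW p0)// ler_pXn2r// nnegrE ltW.
have h3 : r ^+ 3 <= p ^+ 3 by rewrite ler_pXn2r// nnegrE ltW.
rewrite -!exprS -exprSr in h1 h2 *; lra.
Qed.

Lemma harmonic_le n : \sum_(i < n.+1) i.+1%:R^-1 <= 1 + ln n.+1%:R :> R.
Proof.
elim: n => [|n IHn]; first by rewrite big_ord1 ln1 addr0 invr1.
rewrite big_ord_recr/=; apply: (le_trans (lerD IHn (lexx _))).
rewrite -addrA lerD2l -lerBrDl.
have n2 : 0 < n.+2%:R :> R by [].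
have : ln (1 + (- n.+2%:R^-1)) <= - n.+2%:R^-1 :> R.
  by apply: le_ln1Dx; rewrite ltrN2 invf_lt1// ltr1n.
have -> : 1 + (- n.+2%:R^-1) = n.+1%:R / n.+2%:R :> R.
  by rewrite -[n.+1%:R](addrK 1) natr1 mulrBl mul1r divff.
by rewrite ln_div ?posrE// lerNr opprB.
Qed.

End quartic_root.

(** * The averaged oracle noise *)

(** The moving average of the centred oracle answers: the share of the momentum
    error [m_n - grad F x_n] for which the oracle is responsible. *)
Fixpoint nsgdm_noise (R : realType) (d : nat) (Xi : Type) (eta beta : nat -> R)
    (F : 'rV[R]_d -> R) (g : 'rV[R]_d -> Xi -> 'rV[R]_d) (x1 : 'rV[R]_d)
    (z : nat -> Xi) (n : nat) : 'rV[R]_d :=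
  if n is n'.+1 then
    let x := (nsgdm_state eta beta g x1 z n').1 in
    beta n *: nsgdm_noise eta beta F g x1 z n' +
    (1 - beta n) *: (g x (z n) - grad F x)
  else 0.

Section noise.
Context (R : realType) (d : nat) (disp disp' : measure_display)
  (Omega : measurableType disp) (Xi : measurableType disp')
  (P : probability Omega R) (F : 'rV[R]_d -> R) (L0 L1 sigma : R)
  (g : 'rV[R]_d -> Xi -> 'rV[R]_d)
  (xi : {RV P >-> Xi}) (xis : nat -> {RV P >-> Xi}) (x1 : 'rV[R]_d).
Hypotheses (L00 : 0 <= L0) (L10 : 0 <= L1).
Hypotheses (smF : L0L1_smooth L0 L1 F) (mg : measurable_oracle g).
Hypotheses (unb : unbiased_oracle F g xi)
  (bvar : bounded_variance_oracle F g xi sigma) (iid : iid_samples xi xis).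
Variables (eta beta : nat -> R).

Let S := (borel_rV R d * borel_rV R d * borel_rV R d)%type.
Let s1 : S := (x1, 0, 0).

(** The noise is made part of the state, so that the whole triple of iterate,
    momentum and noise is a recursion driven by the samples. *)
Definition aug_step (n : nat) (s : S) (z : Xi) : S :=
  let: (x, m, e) := s in
  let m' := beta n *: (m : 'rV[R]_d) + (1 - beta n) *: g x z in
  ((x : 'rV[R]_d) - (eta n / enorm m') *: m', m',
   beta n *: (e : 'rV[R]_d) + (1 - beta n) *: (g x z - grad F x)).

Lemma measurable_aug_step n :
  measurable_fun [set: S * Xi] (fun p => aug_step n p.1 p.2).
Proof.
have mx : measurable_fun [set: S * Xi] (fun p => p.1.1.1).
  exact: (measurableT_comp measurable_fst
    (measurableT_comp measurable_fst measurable_fst)).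
have mm : measurable_fun [set: S * Xi] (fun p => p.1.1.2).
  exact: (measurableT_comp measurable_snd
    (measurableT_comp measurable_fst measurable_fst)).
have me : measurable_fun [set: S * Xi] (fun p => p.1.2).
  exact: (measurableT_comp measurable_snd measurable_fst).
have mgx : measurable_fun [set: S * Xi]
    (fun p => g p.1.1.1 p.2 : borel_rV R d).
  have mg' : measurable_fun [set: borel_rV R d * Xi]
    (fun p => g p.1 p.2 : borel_rV R d) := mg.
  exact: (measurableT_comp mg' (measurable_fun_pair mx measurable_snd)).
have mG : measurable_fun [set: S * Xi] (fun p => grad F p.1.1.1 : borel_rV R d).
  exact: (measurableT_comp (measurable_grad L00 L10 smF)).
have mZ (a : R) (f : S * Xi -> borel_rV R d) : measurable_fun [set: S * Xi] f ->
    measurable_fun [set: S * Xi] (fun p => a *: (f p : 'rV[R]_d) : borel_rV R d).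
  by move=> mf; apply: measurable_rVZ.
have mm' : measurable_fun [set: S * Xi] (fun p => beta n *: (p.1.1.2 : 'rV[R]_d) +
    (1 - beta n) *: g p.1.1.1 p.2 : borel_rV R d).
  by apply: measurable_rVD; exact: mZ.
rewrite (_ : (fun p => _) = (fun p : S * Xi =>
    let m' := beta n *: (p.1.1.2 : 'rV[R]_d) + (1 - beta n) *: g p.1.1.1 p.2 in
    ((p.1.1.1 : 'rV[R]_d) - (eta n / enorm m') *: m', m',
    beta n *: (p.1.2 : 'rV[R]_d) +
    (1 - beta n) *: (g p.1.1.1 p.2 - grad F p.1.1.1)) : S)); last first.
  by apply/funext => -[[[]]].
apply: measurable_fun_pair; first apply: measurable_fun_pair => //.
- apply: measurable_rVB => //; apply: measurable_rVZ => //.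
  apply: measurable_funM => //.
  exact: measurable_enormV.
- by apply: measurable_rVD; apply: mZ => //; exact: measurable_rVB.
Qed.

Lemma driven_aug_stepE n w :
  driven aug_step s1 xis n w =
  (nsgdm_state eta beta g x1 (fun s => xis s w) n,
   nsgdm_noise eta beta F g x1 (fun s => xis s w) n).
Proof.
by elim: n => [//|n IHn] /=; rewrite IHn /=; case: (nsgdm_state _ _ _ _ _ _).
Qed.

Lemma measurable_iterate n : measurable_fun [set: Omega]
  (fun w => (nsgdm_state eta beta g x1 (fun s => xis s w) n).1 : borel_rV R d).
Proof.
have := measurable_driven s1 xis measurable_aug_step n.
rewrite (_ : driven _ _ _ _ = fun w => (nsgdm_state eta beta g x1 (fun s => xis s w) n,
   nsgdm_noise eta beta F g x1 (fun s => xis s w) n) : S); last first.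
  by apply/funext => w; rewrite driven_aug_stepE.
by move=> /measurable_fun_pairP[/measurable_fun_pairP[]].
Qed.

Lemma measurable_noise n : measurable_fun [set: Omega]
  (fun w => nsgdm_noise eta beta F g x1 (fun s => xis s w) n : borel_rV R d).
Proof.
have := measurable_driven s1 xis measurable_aug_step n.
rewrite (_ : driven _ _ _ _ = fun w => (nsgdm_state eta beta g x1 (fun s => xis s w) n,
   nsgdm_noise eta beta F g x1 (fun s => xis s w) n) : S); last first.
  by apply/funext => w; rewrite driven_aug_stepE.
by move=> /measurable_fun_pairP[].
Qed.

Lemma oracle_error_moments x :
  (forall i, P.-integrable setT (fun w => ((g x (xi w) - grad F x) 0 i)%:E) /\
     (\int[P]_w ((g x (xi w) - grad F x) 0 i)%:E = 0)%E) /\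
  (\int[P]_w (enorm (g x (xi w) - grad F x) ^+ 2)%:E <= (sigma ^+ 2)%:E)%E.
Proof.
split; last by have := bvar x; rewrite unlock.
move=> i; have [ig] := unb x i; rewrite unlock => Eg.
have ic : P.-integrable setT (fun=> (grad F x 0 i)%:E).
  exact: finite_measure_integrable_cst.
rewrite (_ : (fun w => _) =
    (fun w => (g x (xi w) 0 i)%:E - (grad F x 0 i)%:E)%E); last first.
  by apply/funext => w; rewrite -EFinB !mxE.
split; first exact: integrableB.
by rewrite integralB// Eg integral_probability_cst subee.
Qed.

(** Given the past, the fresh oracle error is centred, hence orthogonal to the
    noise accumulated so far. *)
Lemma noise_second_moment_step n :
  (\int[P]_w (enorm (nsgdm_noise eta beta F g x1 (fun s => xis s w) n.+1) ^+ 2)%:E <=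
   (beta n.+1 ^+ 2)%:E *
     \int[P]_w (enorm (nsgdm_noise eta beta F g x1 (fun s => xis s w) n) ^+ 2)%:E +
   ((1 - beta n.+1) ^+ 2 * sigma ^+ 2)%:E)%E.
Proof.
pose h (p : S * Xi) := (enorm ((aug_step n.+1 p.1 p.2).2 : 'rV[R]_d) ^+ 2)%:E.
have mh : measurable_fun setT h.
  apply/measurable_EFinP; apply: measurable_funX; apply: measurable_enorm.
  exact: (measurableT_comp measurable_snd (measurable_aug_step n.+1)).
have h0 p : (0 <= h p)%E by rewrite lee_fin sqr_ge0.
have mN k : measurable_fun setT (fun w =>
    (enorm (nsgdm_noise eta beta F g x1 (fun s => xis s w) k) ^+ 2)%:E).
  apply/measurable_EFinP; apply: measurable_funX; apply: measurable_enorm.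
  exact: measurable_noise.
have -> : (\int[P]_w
     (enorm (nsgdm_noise eta beta F g x1 (fun s => xis s w) n.+1) ^+ 2)%:E =
   \int[P]_w h (driven aug_step s1 xis n w, xis n.+1 w))%E.
  apply: eq_integral => w _; rewrite /h driven_aug_stepE/=.
  by case: (nsgdm_state _ _ _ _ _ _).
rewrite (@integral_driven_input _ _ _ _ _ _ _ _ _ s1 xis measurable_aug_step
  (proj2 iid) xi)//; last first.
  by move=> A mA; apply: (proj1 iid).
apply: (@le_trans _ _ (\int[P]_w ((beta n.+1 ^+ 2)%:E *
    (enorm (nsgdm_noise eta beta F g x1 (fun s => xis s w) n) ^+ 2)%:E +
    ((1 - beta n.+1) ^+ 2 * sigma ^+ 2)%:E))%E).
  apply: ge0_le_integral => //.
  - by move=> w _; exact: integral_ge0.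
  - apply: (measurableT_comp (f := fun s => (\int[P]_w' h (s, xi w'))%E)).
      exact: measurable_integral_input.
    exact: measurable_driven _ _ measurable_aug_step _.
  - by apply: emeasurable_funD => //; exact: emeasurable_funM.
  - move=> w _; rewrite driven_aug_stepE /h/=.
    case: (nsgdm_state _ _ _ _ _ _) => x m /=.
    have [v0 v2] := oracle_error_moments x.
    exact: second_moment_affine.
rewrite ge0_integralD//; last 3 first.
- by move=> w _; rewrite -EFinM lee_fin mulr_ge0// sqr_ge0.
- exact: emeasurable_funM.
- by move=> w _; rewrite lee_fin mulr_ge0// sqr_ge0.
rewrite ge0_integralZl//; last 2 first.
- by move=> w _; rewrite lee_fin sqr_ge0.
- by rewrite lee_fin sqr_ge0.
by rewrite integral_probability_cst.
Qed.

End noise.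

Section noise_bound.
Context (R : realType) (d : nat) (disp disp' : measure_display)
  (Omega : measurableType disp) (Xi : measurableType disp')
  (P : probability Omega R) (F : 'rV[R]_d -> R) (L0 L1 sigma : R)
  (g : 'rV[R]_d -> Xi -> 'rV[R]_d)
  (xi : {RV P >-> Xi}) (xis : nat -> {RV P >-> Xi}) (x1 : 'rV[R]_d).
Hypotheses (L00 : 0 <= L0) (L10 : 0 <= L1) (sigma0 : 0 <= sigma).
Hypotheses (smF : L0L1_smooth L0 L1 F) (mg : measurable_oracle g).
Hypotheses (unb : unbiased_oracle F g xi)
  (bvar : bounded_variance_oracle F g xi sigma) (iid : iid_samples xi xis).
Variable eta : nat -> R.

Let N n w := nsgdm_noise eta (@beta_sched R) F g x1 (fun s => xis s w) n.

Lemma noise_second_moment n :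
  (\int[P]_w (enorm (N n w) ^+ 2)%:E <= (sigma ^+ 2 * (qroot R n ^+ 2)^-1)%:E)%E.
Proof.
elim: n => [|n IHn].
  rewrite (_ : (fun w => _) = cst 0%E); last first.
    by apply/funext => w; rewrite /N /= enorm0 expr0n.
  by rewrite integral0 lee_fin mulr_ge0 ?invr_ge0 ?sqr_ge0.
have := noise_second_moment_step x1 L00 L10 smF mg unb bvar iid eta (@beta_sched R) n.
move=> /le_trans; apply.
apply: (@le_trans _ _ ((beta_sched R n.+1 ^+ 2)%:E *
   (sigma ^+ 2 * (qroot R n ^+ 2)^-1)%:E + ((1 - beta_sched R n.+1) ^+ 2 * sigma ^+ 2)%:E)%E).
  by rewrite leeD2r// lee_wpmul2l// lee_fin sqr_ge0.
rewrite -EFinM -EFinD lee_fin beta_schedE opprB addrCA subrr addr0.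
rewrite mulrCA [X in _ + X]mulrC -mulrDr ler_wpM2l ?sqr_ge0//.
exact: qroot_variance_step.
Qed.

Lemma noise_first_moment n :
  (\int[P]_w (enorm (N n w))%:E <= (sigma / qroot R n)%:E)%E.
Proof.
apply: first_moment_le.
- by rewrite divr_ge0// qroot_ge0.
- by apply: measurable_enorm; exact: (measurable_noise xis x1 L00 L10 smF mg).
- by move=> w; exact: enorm_ge0.
- by rewrite expr_div_n; exact: noise_second_moment.
Qed.

End noise_bound.

(** * A potential for gradients and drift *)

Section lyapunov.
Context (R : realType).

Let q n := qroot R n.+1.
Let eta n := eta_sched R n.+1.

(** One step of the potential [F x_t + (3/7) t^(-1/4) |drift_t|], where
    [W = t^(-1/4)], [W' = (t + 1)^(-1/4)] and [h = eta_t].  The drift [bn]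
    contracts by [1 - W' ^+ 2], which pays for [2 h bn]; the two terms
    proportional to [L0 + L1 en] add up to [(16/21) (L0 + L1 en) h W], and
    [L1 W <= 1] leaves [5/21] of the descent [h en]. *)
Lemma late_step_arith (L0 L1 h en bn dn bn1 fn fn1 vn W W' : R) :
  0 <= L0 -> 0 <= L1 -> h = W ^+ 3 / 7 ->
  fn1 <= fn - h * en + 2 * h * (vn + bn) + 4 / 3 * (L0 + L1 * en) * h ^+ 2 ->
  dn <= 4 / 3 * (L0 + L1 * en) * h ->
  bn1 <= (1 - W' ^+ 2) * (bn + dn) ->
  0 <= en -> 0 <= bn -> 0 <= dn -> 2 * W ^+ 2 <= 3 * W' ^+ 2 -> W' <= W ->
  L1 * W <= 1 -> W <= 1 -> 0 < W -> 0 < W' ->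
  5 / 21 * (h * en) + fn1 + 3 / 7 * W' * bn1 <=
  fn + 3 / 7 * W * bn + 2 * (h * vn) + 16 / 147 * L0 * W ^+ 4.
Proof.
move=> L00 L10 etaE Ef Ed Eb En Bn Dn step W'W L1W W1 W0 W'0.
have W'1 : 0 <= 1 - W' ^+ 2.
  by rewrite subr_ge0 expr_le1// ?(le_trans W'W)// ltW.
have h0 : 0 < h by rewrite etaE divr_gt0// exprn_gt0.
(* the contraction of the drift pays for the term 2 h bn of the descent *)
have k1 : W' * bn1 <= W * bn - 2 / 3 * W ^+ 3 * bn + W * dn.
  have t1 : W' * bn1 <= W * ((1 - W' ^+ 2) * (bn + dn)).
    apply: (@le_trans _ _ (W' * ((1 - W' ^+ 2) * (bn + dn)))).
      by rewrite ler_wpM2l// ltW.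
    by rewrite ler_wpM2r// mulr_ge0// addr_ge0.
  have t2 : W * bn * (2 * W ^+ 2) <= W * bn * (3 * W' ^+ 2).
    by rewrite ler_wpM2l// mulr_ge0// ltW.
  have t3 : 0 <= W * dn * W' ^+ 2 by rewrite !mulr_ge0 ?sqr_ge0// ltW.
  lra.
have k2 : W * dn <= 4 / 3 * (L0 + L1 * en) * (h * W).
  by rewrite [in leRHS]mulrA mulrC ler_wpM2r// ltW.
have c0 : 0 <= L0 + L1 * en by rewrite addr_ge0// mulr_ge0.
have k3 : 4 / 3 * (L0 + L1 * en) * h ^+ 2 <= 4 / 3 * (L0 + L1 * en) * (h * W / 7).
  rewrite ler_wpM2l ?mulr_ge0// expr2 -mulrA ler_wpM2l ?(ltW h0)//.
  by rewrite etaE ler_wpM2r// exprS ler_piMr ?(ltW W0)// expr_le1// ltW.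
have k4 : (L0 + L1 * en) * (h * W) <= L0 * (W ^+ 4 / 7) + h * en.
  have t : (h * en) * (L1 * W) <= (h * en) * 1 by rewrite ler_wpM2l// mulr_ge0// ltW.
  have -> : W ^+ 4 / 7 = h * W by rewrite etaE; ring.
  lra.
have k5 : h * bn = W ^+ 3 * bn / 7 by rewrite etaE; ring.
lra.
Qed.

(** The index [n] stands for the time [n + 1]: [f] is the objective, [e] the norm
    of the gradient, [v] that of the noise, [b] that of the drift, and [dl] bounds
    the change of the gradient in the step.  An index is early if [q n < L1] and
    late otherwise. *)
Variables (L0 L1 G Fstar : R) (f e v b dl : nat -> R).
Hypotheses (L00 : 0 <= L0) (L10 : 0 <= L1) (G0 : 0 <= G).
Hypotheses (e0 : forall n, 0 <= e n) (v0 : forall n, 0 <= v n)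
  (b0 : forall n, 0 <= b n) (dl0 : forall n, 0 <= dl n).
Hypotheses (fge : forall n, Fstar <= f n) (b00 : b 0 = 0).
Hypothesis bS : forall n, b n.+1 <= (1 - (q n.+1 ^+ 2)^-1) * (b n + dl n).
Hypothesis dl_le : forall n, dl n <= e n + e n.+1.
Hypothesis early : forall n, (forall i, (i < n)%N -> q i < L1) ->
  e n <= G /\ f n <= f 0 + 4 / 7 * L1 * G.
Hypothesis late_f : forall n, L1 <= q n ->
  f n.+1 <= f n - eta n * e n + 2 * eta n * (v n + b n) +
    4 / 3 * (L0 + L1 * e n) * eta n ^+ 2.
Hypothesis late_dl : forall n, L1 <= q n ->
  dl n <= 4 / 3 * (L0 + L1 * e n) * eta n.

Let B := (f 0 - Fstar) + L1 * G + G * L1 ^+ 4.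
Let rhs n := B + 2 * \sum_(i < n) eta i * v i +
  16 / 147 * L0 * \sum_(i < n) i.+1%:R^-1.

Lemma q_exp4_le n : (forall i, (i < n)%N -> q i < L1) -> n%:R <= L1 ^+ 4.
Proof.
case: n => [|n] E; first by rewrite exprn_ge0.
rewrite -qroot_exp4 ler_pXn2r ?nnegrE ?qroot_ge0//.
exact/ltW/E.
Qed.

Lemma qroot_lt_early n : (forall i, (i < n)%N -> q i < L1) -> qroot R n <= L1.
Proof. by case: n => [|n] E; [rewrite qroot0|exact/ltW/E]. Qed.

Lemma early_drift n : (forall i, (i < n)%N -> q i < L1) -> b n <= 2 * G * n%:R.
Proof.
elim: n => [|n IHn] E; first by rewrite b00 mulr0.
have E' i : (i < n)%N -> q i < L1 by move=> ni; apply: E; exact: ltnW.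
apply: (le_trans (bS n)).
apply: (@le_trans _ _ (b n + dl n)).
  by rewrite ler_piMl ?addr_ge0// gerBl invr_ge0 sqr_ge0.
have [en _] := early E'; have [en1 _] := early E.
have := IHn E'; have := dl_le n; rewrite -natr1; lra.
Qed.

(** While all past indices are early there are at most [L1^4] of them, and crude
    bounds by [G] suffice. *)
Lemma early_potential n : (forall i, (i < n)%N -> q i < L1) ->
  5 / 21 * (\sum_(i < n) eta i * e i) + (f n - Fstar) + 3 / 7 * (q n)^-1 * b n
    <= rhs n.
Proof.
move=> E; have [_ fn] := early E.
have s1 : \sum_(i < n) eta i * e i <= 4 / 7 * L1 * G.
  apply: (@le_trans _ _ (\sum_(i < n) eta i * G)).
    apply: ler_sum => i _; rewrite ler_wpM2l ?(ltW (eta_gt0 R _))//.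
    have [] // : e i <= G /\ f i <= f 0 + 4 / 7 * L1 * G.
    by apply: early => j ji; apply: E; exact: ltn_trans ji _.
  rewrite -mulr_suml ler_wpM2r//; apply: (le_trans (sum_eta_le R n)).
  by rewrite ler_wpM2l// qroot_lt_early.
have s2 : (q n)^-1 * b n <= 2 * (G * L1 ^+ 4).
  apply: (@le_trans _ _ (b n)).
    by rewrite ler_piMl// invf_le1 ?qroot_ge1// qroot_gt0.
  apply: (le_trans (early_drift E)); rewrite -mulrA ler_wpM2l// ler_wpM2l//.
  exact: q_exp4_le.
have r1 : 0 <= \sum_(i < n) eta i * v i.
  by apply: sumr_ge0 => i _; rewrite mulr_ge0 ?(ltW (eta_gt0 R _)).
have r2 : 0 <= L0 * \sum_(i < n) (i.+1%:R^-1 : R).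
  by rewrite mulr_ge0// sumr_ge0// => i _; rewrite invr_ge0.
have r3 : 0 <= L1 * G by rewrite mulr_ge0.
have r4 : 0 <= G * L1 ^+ 4 by rewrite mulr_ge0// exprn_ge0.
rewrite /rhs /B; lra.
Qed.

Lemma late_potential_step n : L1 <= q n ->
  5 / 21 * (eta n * e n) + f n.+1 + 3 / 7 * (q n.+1)^-1 * b n.+1 <=
  f n + 3 / 7 * (q n)^-1 * b n + 2 * (eta n * v n) + 16 / 147 * L0 * n.+1%:R^-1.
Proof.
move=> late.
have p1 : 1 <= q n by exact: qroot_ge1.
have p0 : 0 < q n by exact: qroot_gt0.
have rp0 : 0 < q n.+1 by exact: qroot_gt0.
have pr : q n <= q n.+1 by exact: qroot_le.
have Ef := late_f late; have Ed := late_dl late; have Eb := bS n.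
have En := e0 n; have Bn := b0 n; have Dn := dl0 n.
have p4 : n.+1%:R^-1 = (q n)^-1 ^+ 4 by rewrite exprVn qroot_exp4.
have etaE : eta n = (q n)^-1 ^+ 3 / 7 by rewrite /eta eta_schedE exprVn.
have rE : (q n.+1 ^+ 2)^-1 = (q n.+1)^-1 ^+ 2 by rewrite exprVn.
rewrite rE in Eb; rewrite p4.
have step : 2 * (q n)^-1 ^+ 2 <= 3 * (q n.+1)^-1 ^+ 2.
  rewrite !exprVn ler_pdivlMr ?exprn_gt0// mulrAC ler_pdivrMr ?exprn_gt0//.
  rewrite -(@ler_pXn2r _ 2)// ?nnegrE ?mulr_ge0 ?qroot_ge0//.
  rewrite [leLHS]exprMn [leRHS]exprMn -!exprM !qroot_exp4 -[n.+2%:R]natr1.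
  have : 1 <= n.+1%:R :> R by rewrite ler1n.
  lra.
have W'W : (q n.+1)^-1 <= (q n)^-1 by rewrite lef_pV2.
have L1W : L1 * (q n)^-1 <= 1 by rewrite ler_pdivrMr// mul1r.
have W1 : (q n)^-1 <= 1 by rewrite invf_le1.
have W0 : 0 < (q n)^-1 by rewrite invr_gt0.
have W'0 : 0 < (q n.+1)^-1 by rewrite invr_gt0.
by have := late_step_arith L00 L10 etaE Ef Ed Eb En Bn Dn step W'W L1W W1 W0 W'0.
Qed.

(** After the first late index all steps are late, so the step inequality can be
    iterated from the last time at which the early bound applies. *)
Lemma potential_le n :
  5 / 21 * (\sum_(i < n) eta i * e i) + (f n - Fstar) + 3 / 7 * (q n)^-1 * b n
    <= rhs n.
Proof.
have [E|E] := pselect (forall i, (i < n)%N -> q i < L1).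
  exact: early_potential.
elim: n E => [|n IHn] E; first by exfalso; apply: E.
have late : L1 <= q n.
  rewrite leNgt; apply/negP => nE; apply: E => i.
  rewrite ltnS => ni; apply: le_lt_trans nE; exact: qroot_le.
have {}IHn : 5 / 21 * (\sum_(i < n) eta i * e i) + (f n - Fstar) +
    3 / 7 * (q n)^-1 * b n <= rhs n.
  have [E'|] := pselect (forall i, (i < n)%N -> q i < L1); last exact: IHn.
  exact: early_potential.
move: IHn (late_potential_step late); rewrite /rhs !big_ord_recr/=.
by move: (3 / 7 / q n * b n) (3 / 7 / q n.+1 * b n.+1) n.+1%:R^-1 B => x y z C; lra.
Qed.

Lemma sum_eta_grad_le n : \sum_(i < n) eta i * e i <= 21 / 5 * rhs n.
Proof.
have := potential_le n; have := fge n.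
have : 0 <= 3 / 7 * (q n)^-1 * b n by rewrite !mulr_ge0// invr_ge0 qroot_ge0.
lra.
Qed.

End lyapunov.

(** * Pathwise bound along a trajectory *)

Section trajectory.
Context (R : realType) (d : nat) (Xi : Type) (F : 'rV[R]_d -> R)
  (L0 L1 Fstar : R) (g : 'rV[R]_d -> Xi -> 'rV[R]_d) (x1 : 'rV[R]_d)
  (z : nat -> Xi).
Hypotheses (L00 : 0 <= L0) (L10 : 0 <= L1) (smF : L0L1_smooth L0 L1 F)
  (Fge : forall x, Fstar <= F x).

Let eta := @eta_sched R.
Let beta := @beta_sched R.
Let X n := (nsgdm_state eta beta g x1 z n).1.
Let M n := (nsgdm_state eta beta g x1 z n).2.
Let N n := nsgdm_noise eta beta F g x1 z n.
Let G := expR (L1 * (4 / 7 * L1)) * (enorm (grad F x1) + L0 * (4 / 7 * L1)).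
(** The rest of the momentum error, which only moves when the gradient does. *)
Let drift n := M n.+1 - grad F (X n) - N n.+1.

Lemma nsgdm_stateS n :
  M n.+1 = beta n.+1 *: M n + (1 - beta n.+1) *: g (X n) (z n.+1) /\
  X n.+1 = X n - (eta n.+1 / enorm (M n.+1)) *: M n.+1.
Proof. by rewrite /M /X /=; case: (nsgdm_state _ _ _ _ _ _). Qed.

Lemma driftS n : drift n.+1 = beta n.+2 *: (drift n + (grad F (X n) - grad F (X n.+1))).
Proof.
rewrite /drift; have [-> _] := nsgdm_stateS n.+1.
rewrite /N [nsgdm_noise _ _ _ _ _ _ n.+2]/= -/(N n.+1) -/(X n.+1).
apply/rowP => i; rewrite !mxE; ring.
Qed.

Lemma drift0 : drift 0 = 0.
Proof.
rewrite /drift; have [-> _] := nsgdm_stateS 0; rewrite /M /N /X /=.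
have -> : beta 1 = 0 by rewrite /beta beta_schedE /qroot powR1 expr1n invr1 subrr.
by rewrite !scale0r subr0 !scale1r !add0r subrr.
Qed.

Lemma nsgdm_dist_le n : enorm (x1 - X n) <= 4 / 7 * qroot R n.
Proof.
apply: le_trans (sum_eta_le R n); elim: n => [|n IHn].
  by rewrite big_ord0 /X /= subrr enorm0.
rewrite big_ord_recr/=; apply: (le_trans (enormB_triangle _ (X n) _)).
apply: lerD => //; have [_ ->] := nsgdm_stateS n.
by rewrite opprB addrC subrK enorm_normalized_le// ltW// eta_gt0.
Qed.

(** All early steps together have length at most [(4/7) L1], so the gradient
    exceeds its initial size by a factor [exp ((4/7) L1^2)] at most.  The divisor 7
    in the stepsize is what keeps this exponent below [L1^2]. *)
Lemma initial_phase_bounds n : (forall i, (i < n)%N -> qroot R i.+1 < L1) ->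
  enorm (grad F (X n)) <= G /\ F (X n) <= F x1 + 4 / 7 * L1 * G.
Proof.
have gx0 := enorm_ge0 (grad F x1).
have G0 : 0 <= G by rewrite mulr_ge0 ?expR_ge0// addr_ge0// !mulr_ge0.
case: n => [_|n E].
  rewrite /X /=; split; last by rewrite lerDl mulr_ge0// !mulr_ge0.
  have := expR_ge1Dx (L1 * (4 / 7 * L1)) => h.
  have r0 : 0 <= L0 * (4 / 7 * L1) by rewrite !mulr_ge0.
  have l0 : 0 <= L1 * (4 / 7 * L1) by rewrite !mulr_ge0.
  rewrite /G; apply: (@le_trans _ _ (1 * (enorm (grad F x1) + L0 * (4 / 7 * L1)))).
    by rewrite mul1r lerDl.
  by rewrite ler_wpM2r ?addr_ge0//; lra.
have L1p : 0 < L1 by exact: lt_trans (qroot_gt0 R n) (E n (ltnSn n)).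
have xr : enorm (x1 - X n.+1) <= 4 / 7 * L1.
  apply: (le_trans (nsgdm_dist_le n.+1)).
  by rewrite ler_wpM2l// ltW// E.
have grow y : enorm (x1 - y) <= 4 / 7 * L1 -> enorm (grad F y) <= G.
  by move=> yr; apply: (grad_growth L00 L10 smF yr); rewrite !mulr_gt0.
split; first exact: grow.
have [s /andP[s0 s1]] := mean_value_segment (proj1 smF) x1 (X n.+1 - x1).
rewrite [x1 + (_ - _)]addrC subrK => Es.
have h : dotv (grad F (x1 + s *: (X n.+1 - x1))) (X n.+1 - x1) <= G * (4 / 7 * L1).
  apply: (le_trans (cauchy_schwarz _ _)); apply: ler_pM; rewrite ?enorm_ge0//.
    apply: grow; rewrite opprD addrA subrr sub0r enormN enormZ ger0_norm// enormBC.
    by rewrite (le_trans _ xr)// ler_piMl// enorm_ge0.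
  by rewrite enormBC.
lra.
Qed.

Lemma late_step_small n : L1 <= qroot R n.+1 -> L1 * eta n.+1 <= 4^-1.
Proof.
move=> late; have e0 : 0 < eta n.+1 by exact: eta_gt0.
have p1 := qroot_ge1 R n; have p0 := qroot_gt0 R n.
apply: (le_trans (ler_wpM2r (ltW e0) late)).
rewrite /eta eta_schedE mulrA exprS invfM mulrA divff ?gt_eqF// mul1r.
have : (qroot R n.+1 ^+ 2)^-1 <= 1.
  by rewrite invf_le1 ?exprn_gt0// exprn_ege1.
lra.
Qed.

Lemma nsgdm_descent n : L1 <= qroot R n.+1 ->
  F (X n.+1) <= F (X n) - eta n.+1 * enorm (grad F (X n)) +
    2 * eta n.+1 * (enorm (N n.+1) + enorm (drift n)) +
    4 / 3 * (L0 + L1 * enorm (grad F (X n))) * eta n.+1 ^+ 2.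
Proof.
move=> late; have e0 : 0 < eta n.+1 by exact: eta_gt0.
have [_ ->] := nsgdm_stateS n.
have L1e := late_step_small late.
have hn : enorm (- ((eta n.+1 / enorm (M n.+1)) *: M n.+1)) <= eta n.+1.
  by rewrite enormN enorm_normalized_le// ltW.
have h1 := descent L00 L10 smF (X n) hn L1e.
have h2 := dotv_normalized_le (grad F (X n)) (M n.+1) (ltW e0).
have h3 : enorm (M n.+1 - grad F (X n)) <= enorm (drift n) + enorm (N n.+1).
  by rewrite -[X in enorm X <= _](subrK (N n.+1)) enorm_triangle.
have h4 := ler_wpM2l (ltW e0) h3.
lra.
Qed.

Lemma grad_diff_le n : L1 <= qroot R n.+1 ->
  enorm (grad F (X n) - grad F (X n.+1)) <=
    4 / 3 * (L0 + L1 * enorm (grad F (X n))) * eta n.+1.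
Proof.
move=> late; have e0 : 0 < eta n.+1 by exact: eta_gt0.
have L1e := late_step_small late.
apply: grad_lipschitz_near => //.
have [_ ->] := nsgdm_stateS n.
by rewrite opprB addrC subrK enorm_normalized_le// ltW.
Qed.

Lemma weighted_grad_sum_le n :
  \sum_(i < n) eta i.+1 * enorm (grad F (X i)) <=
  21 / 5 * ((F x1 - Fstar + L1 * G + G * L1 ^+ 4) +
    2 * (\sum_(i < n) eta i.+1 * enorm (N i.+1)) +
    16 / 147 * L0 * \sum_(i < n) i.+1%:R^-1).
Proof.
have G0 : 0 <= G by rewrite mulr_ge0 ?expR_ge0// addr_ge0 ?enorm_ge0// !mulr_ge0.
apply: (@sum_eta_grad_le R L0 L1 G Fstar (fun n => F (X n))
  (fun n => enorm (grad F (X n))) (fun n => enorm (N n.+1))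
  (fun n => enorm (drift n))
  (fun n => enorm (grad F (X n) - grad F (X n.+1)))) => //.
- by move=> k; exact: enorm_ge0.
- by move=> k; exact: enorm_ge0.
- by move=> k; exact: enorm_ge0.
- by move=> k; exact: enorm_ge0.
- by rewrite drift0 enorm0.
- move=> k; rewrite driftS enormZ /beta beta_schedE ger0_norm; last first.
    by rewrite subr_ge0 invf_le1 ?exprn_ege1 ?qroot_ge1// exprn_gt0// qroot_gt0.
  rewrite ler_wpM2l ?enorm_triangle// subr_ge0.
  by rewrite invf_le1 ?exprn_ege1 ?qroot_ge1// exprn_gt0// qroot_gt0.
- by move=> k; have := enorm_triangle (grad F (X k)) (- grad F (X k.+1)); rewrite enormN.
- exact: initial_phase_bounds.
- exact: nsgdm_descent.
- exact: grad_diff_le.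
Qed.

(** From [L1^2 / 7 <= exp (L1^2 / 7)]; three powers of [exp (L1^2 / 7)] are what
    [exp ((4/7) L1^2)] leaves of [exp (L1^2)]. *)
Lemma expR_absorbs_poly : (1 + L1) * (L1 + L1 ^+ 4) <=
  265 * expR (L1 ^+ 2 / 7) ^+ 3.
Proof.
have s0 := sqr_ge0 L1.
have E1 : 1 + L1 ^+ 2 / 7 <= expR (L1 ^+ 2 / 7) by exact: expR_ge1Dx.
set E := expR _ in E1 *.
have E2 : L1 ^+ 2 <= 7 * E by lra.
have E3 : 1 <= E by lra.
have E4 : L1 <= 4 * E by have := sqr_ge0 (L1 - 1); nra.
have L1' := L10.
have h1 : L1 ^+ 4 <= 49 * E ^+ 2.
  have -> : L1 ^+ 4 = L1 ^+ 2 * L1 ^+ 2 by ring.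
  have -> : 49 * E ^+ 2 = (7 * E) * (7 * E) by ring.
  by apply: ler_pM.
have h2 : L1 <= 4 * E ^+ 2.
  apply: (le_trans E4); rewrite ler_wpM2l// expr2 ler_peMl//; lra.
have -> : 265 * E ^+ 3 = (5 * E) * (53 * E ^+ 2) by ring.
apply: ler_pM; rewrite ?addr_ge0 ?exprn_ge0//; lra.
Qed.

Lemma initial_phase_cost :
  F x1 - Fstar + L1 * G + G * L1 ^+ 4 <=
  1591 * (expR (L1 ^+ 2) * (F x1 - Fstar + L0)).
Proof.
have D0 : 0 <= F x1 - Fstar by rewrite subr_ge0.
have E7 : expR (L1 ^+ 2) = expR (L1 ^+ 2 / 7) ^+ 7.
  by rewrite -expRM_natl; congr expR; field.
have E4 : expR (L1 * (4 / 7 * L1)) = expR (L1 ^+ 2 / 7) ^+ 4.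
  by rewrite -expRM_natl; congr expR; field.
have s0 := sqr_ge0 L1.
have E1 : 1 + L1 ^+ 2 / 7 <= expR (L1 ^+ 2 / 7) by exact: expR_ge1Dx.
have := expR_absorbs_poly; rewrite /G E7 E4.
move: (expR _) E1 => E E1 absorb.
have E10 : 1 <= E by lra.
have gx := enorm_grad_le L00 L10 smF x1 Fge.
move: (enorm _) gx => e gx.
have L1' := L10; have L0' := L00.
have t0 : 0 <= L1 * L0 by rewrite mulr_ge0.
have t1 : e + L0 * (4 / 7 * L1) <= 6 * (1 + L1) * (F x1 - Fstar + L0) by lra.
have P0 : 0 <= L1 + L1 ^+ 4 by rewrite addr_ge0// exprn_ge0.
have E40 : 0 <= E ^+ 4 by rewrite exprn_ge0//; lra.
have S0 : 0 <= F x1 - Fstar + L0 by rewrite addr_ge0.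
have t2 : E ^+ 4 * (e + L0 * (4 / 7 * L1)) * (L1 + L1 ^+ 4) <=
    E ^+ 4 * (6 * (1 + L1) * (F x1 - Fstar + L0)) * (L1 + L1 ^+ 4).
  by rewrite ler_wpM2r// ler_wpM2l.
have t3 : 6 * (F x1 - Fstar + L0) * E ^+ 4 * ((1 + L1) * (L1 + L1 ^+ 4)) <=
    6 * (F x1 - Fstar + L0) * E ^+ 4 * (265 * E ^+ 3).
  by rewrite ler_wpM2l// mulr_ge0// mulr_ge0.
have t4 : F x1 - Fstar + L0 <= E ^+ 7 * (F x1 - Fstar + L0).
  by rewrite ler_peMl// exprn_ege1.
have t5 : E ^+ 4 * E ^+ 3 = E ^+ 7 by rewrite -exprD.
have t6 : 6 * (F x1 - Fstar + L0) * E ^+ 4 * (265 * E ^+ 3) =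
  1590 * (E ^+ 7 * (F x1 - Fstar + L0)) by rewrite -t5; ring.
rewrite t6 in t3.
lra.
Qed.

End trajectory.

(** * The convergence rate in expectation *)

Section expected_gradients.
Context (R : realType) (d : nat) (disp disp' : measure_display)
  (Omega : measurableType disp) (Xi : measurableType disp')
  (P : probability Omega R) (F : 'rV[R]_d -> R) (Fstar L0 L1 sigma : R)
  (g : 'rV[R]_d -> Xi -> 'rV[R]_d)
  (xi : {RV P >-> Xi}) (xis : nat -> {RV P >-> Xi}) (x1 : 'rV[R]_d).
Hypotheses (L00 : 0 <= L0) (L10 : 0 <= L1) (sigma0 : 0 <= sigma)
  (Fge : forall x, Fstar <= F x).
Hypotheses (smF : L0L1_smooth L0 L1 F) (mg : measurable_oracle g).
Hypotheses (unb : unbiased_oracle F g xi)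
  (bvar : bounded_variance_oracle F g xi sigma) (iid : iid_samples xi xis).

Let X n w := (nsgdm_state (@eta_sched R) (@beta_sched R) g x1 (fun s => xis s w) n).1.
Let N n w := nsgdm_noise (@eta_sched R) (@beta_sched R) F g x1 (fun s => xis s w) n.
Let H n : R := \sum_(i < n) i.+1%:R^-1.
Let A := 1591 * (expR (L1 ^+ 2) * (F x1 - Fstar + L0)).

(** The stepsizes decrease, so replacing the weights [eta_t] by uniform ones costs
    [1 / eta_n = 7 n^(3/4)]. *)
Lemma grad_sum_le_weighted n (e : nat -> R) : (forall i, 0 <= e i) ->
  \sum_(i < n) e i <= 7 * qroot R n ^+ 3 * \sum_(i < n) eta_sched R i.+1 * e i.
Proof.
move=> e0; rewrite mulr_sumr; apply: ler_sum => -[i ni] _ /=.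
rewrite mulrA ler_peMl// eta_schedE.
have q0 := qroot_gt0 R i.
have -> : 7 * qroot R n ^+ 3 * ((qroot R i.+1 ^+ 3)^-1 / 7) =
    qroot R n ^+ 3 / qroot R i.+1 ^+ 3 by field; rewrite gt_eqF.
by rewrite ler_pdivlMr ?exprn_gt0// mul1r ler_pXn2r ?nnegrE ?qroot_ge0// qroot_le.
Qed.

(** The pathwise bound is linear in the noise norms, so that only their first
    moments [sigma t^(-1/4)] enter; weighted by [eta_t] they form a harmonic
    sum. *)
Lemma expected_grad_sum_le n :
  (\sum_(i < n) \int[P]_w (enorm (grad F (X i w)))%:E <=
   (147 / 5 * qroot R n ^+ 3 * (A + (2 / 7 * sigma + 16 / 147 * L0) * H n))%:E)%E.
Proof.
set c := 147 / 5 * qroot R n ^+ 3.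
have c0 : 0 <= c.
  by apply: mulr_ge0; rewrite ?exprn_ge0 ?qroot_ge0// mulr_ge0 ?invr_ge0 ?ler0n.
have A0 : 0 <= A.
  by rewrite mulr_ge0 ?ler0n// mulr_ge0 ?expR_ge0// addr_ge0// subr_ge0.
have H0 : 0 <= H n by rewrite sumr_ge0// => i _; rewrite invr_ge0.
have C0 : 0 <= c * (A + 16 / 147 * L0 * H n).
  by rewrite mulr_ge0// addr_ge0// !mulr_ge0 ?invr_ge0 ?ler0n.
have eta0 i : 0 <= eta_sched R i.+1 by exact/ltW/eta_gt0.
have ce0 i : 0 <= 2 * c * eta_sched R i.+1 by rewrite mulr_ge0// mulr_ge0.
have mX i : measurable_fun setT (fun w => (enorm (grad F (X i w)))%:E).
  apply/measurable_EFinP; apply: measurable_enorm.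
  apply: (measurableT_comp (measurable_grad L00 L10 smF)).
  exact: measurable_iterate L00 L10 smF mg _ _ _.
have mN i : measurable_fun setT (fun w => (enorm (N i w))%:E).
  apply/measurable_EFinP; apply: measurable_enorm.
  exact: (measurable_noise xis x1 L00 L10 smF mg).
rewrite -ge0_integral_sum//; last by move=> i w _; rewrite lee_fin enorm_ge0.
apply: (@le_trans _ _ (\int[P]_w ((c * (A + 16 / 147 * L0 * H n))%:E +
    \sum_(i < n) (2 * c * eta_sched R i.+1)%:E * (enorm (N i.+1 w))%:E))%E).
  apply: ge0_le_integral => //.
  - by move=> w _; apply: sume_ge0 => i _; rewrite lee_fin enorm_ge0.
  - exact: emeasurable_sum.
  - apply: emeasurable_funD => //; apply: emeasurable_sum => i.
    exact: emeasurable_funM.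
  - move=> w _; under [X in (_ <= _ + X)%E]eq_bigr do rewrite -EFinM.
    rewrite !sumEFin -EFinD lee_fin.
    have e0 i : 0 <= enorm (grad F (X i w)) by exact: enorm_ge0.
    apply: (le_trans (grad_sum_le_weighted n e0)).
    have h1 := weighted_grad_sum_le g x1 (fun s => xis s w) L00 L10 smF Fge n.
    have h2 := initial_phase_cost x1 L00 L10 smF Fge.
    have q3 : 0 <= 7 * qroot R n ^+ 3 by rewrite mulr_ge0// exprn_ge0// qroot_ge0.
    apply: (le_trans (ler_wpM2l q3 h1)).
    rewrite -/A in h2; have h3 := ler_wpM2l c0 h2.
    have -> : \sum_(i < n) 2 * c * eta_sched R i.+1 * enorm (N i.+1 w) =
        2 * c * \sum_(i < n) eta_sched R i.+1 * enorm (N i.+1 w).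
      by rewrite mulr_sumr; apply: eq_bigr => i _; exact/esym/mulrA.
    rewrite /c /N /H in h3 *; lra.
rewrite ge0_integralD//; last 2 first.
- move=> w _; apply: sume_ge0 => i _.
  by rewrite -EFinM lee_fin mulr_ge0// enorm_ge0.
- by apply: emeasurable_sum => i; exact: emeasurable_funM.
rewrite integral_probability_cst ge0_integral_sum//; last 2 first.
- by move=> i; exact: emeasurable_funM.
- by move=> i w _; rewrite -EFinM lee_fin mulr_ge0// enorm_ge0.
apply: (@le_trans _ _ ((c * (A + 16 / 147 * L0 * H n))%:E +
    \sum_(i < n) (2 * c * eta_sched R i.+1 * (sigma / qroot R i.+1))%:E)%E).
  rewrite leeD2l//; apply: lee_sum => i _.
  rewrite ge0_integralZl//; last 2 first.
  - by move=> w _; rewrite lee_fin enorm_ge0.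
  - by rewrite lee_fin.
  rewrite [leRHS]EFinM lee_wpmul2l ?lee_fin//.
  exact: noise_first_moment L00 L10 sigma0 smF mg unb bvar iid _ _.
rewrite sumEFin -EFinD lee_fin.
have -> : \sum_(i < n) 2 * c * eta_sched R i.+1 * (sigma / qroot R i.+1) =
    c * (2 / 7 * sigma) * H n.
  rewrite mulr_sumr; apply: eq_bigr => i _.
  have q0 := qroot_gt0 R i.
  rewrite eta_schedE -(qroot_exp4 R i.+1); field; rewrite gt_eqF//.
lra.
Qed.

End expected_gradients.

Lemma rate_arith (R : realType) (K D E L0 s H l q : R) :
  0 <= K -> 0 <= D -> 1 <= E -> 0 <= L0 -> 0 <= s -> 0 <= H -> H <= 1 + l ->
  0 <= l -> 0 < q ->
  (q ^+ 4)^-1 * (147 / 5 * q ^+ 3 *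
    (K * (E * (D + L0)) + (2 / 7 * s + 16 / 147 * L0) * H)) <=
  147 / 5 * (K + 1) * (1 + l) * ((D * E + s + E * L0) / q).
Proof.
move=> K0 D0 E1 L00 s0 H0 Hl l0 q0.
set Z := D * E + s + E * L0.
have E0 : 0 <= E by apply: le_trans E1.
have DE0 : 0 <= D * E by rewrite mulr_ge0.
have EL : L0 <= E * L0 by rewrite ler_peMl.
have ZE : E * (D + L0) <= Z by rewrite /Z; lra.
have Z0 : 0 <= Z by rewrite /Z; lra.
have h1 : K * (E * (D + L0)) <= K * (Z * (1 + l)).
  by rewrite ler_wpM2l// (le_trans ZE)// ler_peMr//; lra.
have h2 : (2 / 7 * s + 16 / 147 * L0) * H <= Z * (1 + l).
  by apply: ler_pM => //; rewrite /Z; lra.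
have -> : (q ^+ 4)^-1 * (147 / 5 * q ^+ 3 *
    (K * (E * (D + L0)) + (2 / 7 * s + 16 / 147 * L0) * H)) =
    147 / 5 / q * (K * (E * (D + L0)) + (2 / 7 * s + 16 / 147 * L0) * H).
  by field; rewrite gt_eqF.
have -> : 147 / 5 * (K + 1) * (1 + l) * (Z / q) =
    147 / 5 / q * (K * (Z * (1 + l)) + Z * (1 + l)) by ring.
by rewrite ler_wpM2l ?lerD// !mulr_ge0 ?invr_ge0 ?ler0n// ltW.
Qed.

Theorem theorem2 (R : realType) :
  exists C k : R, 0 < C /\ 0 < k /\
    forall (d : nat) (disp disp' : measure_display)
      (Omega : measurableType disp) (Xi : measurableType disp')
      (P : probability Omega R)
      (F : 'rV[R]_d -> R) (Fstar L0 L1 sigma : R)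
      (g : 'rV[R]_d -> Xi -> 'rV[R]_d)
      (xi : {RV P >-> Xi}) (xis : nat -> {RV P >-> Xi})
      (x1 : 'rV[R]_d),
      (1 <= d)%N ->
      0 <= L0 -> 0 <= L1 -> 0 <= sigma ->
      (forall x, Fstar <= F x) ->
      L0L1_smooth L0 L1 F ->
      measurable_oracle g ->
      unbiased_oracle F g xi ->
      bounded_variance_oracle F g xi sigma ->
      iid_samples xi xis ->
      forall T : nat, (1 <= T)%N ->
        (((T%:R^-1)%R)%:E *
           \sum_(1 <= t < T.+1)
             'E_P[fun w => enorm (grad F
                    (nsgdm (@eta_sched R) (@beta_sched R) g x1
                       (fun s => xis s w) t))]
         <= ((C * (1 + ln T%:R) `^ k *
             (((F x1 - Fstar) * expR (L1 ^+ 2) + sigma + expR (L1 ^+ 2) * L0)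
              / T%:R `^ (1 / 4)))%R)%:E)%E.
Proof.
exists (147 / 5 * (1591 + 1)), 1; split; first lra.
split; first exact: ltr01.
move=> d disp disp' Omega Xi P F Fstar L0 L1 sigma.
move=> g xi xis x1 _ L00 L10 sigma0 Fge smF mg unb bvar iid [//|n] _.
have h := expected_grad_sum_le x1 L00 L10 sigma0 Fge smF mg unb bvar iid n.+1.
rewrite big_add1/= big_mkord; under eq_bigr do rewrite unlock.
apply: (@le_trans _ _ _ _ _ (lee_wpmul2l _ h)); first by rewrite lee_fin.
rewrite -EFinM lee_fin -/(qroot R n.+1).
have l0 : 0 <= ln n.+1%:R :> R by rewrite ln_ge0// ler1n.
rewrite powRr1 ?addr_ge0//.
have -> : (n.+1%:R : R)^-1 = (qroot R n.+1 ^+ 4)^-1 by rewrite qroot_exp4.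
have D0 : 0 <= F x1 - Fstar by rewrite subr_ge0.
have E1 : 1 <= expR (L1 ^+ 2).
  by have := expR_ge1Dx (L1 ^+ 2); have := sqr_ge0 L1; lra.
have H0 : 0 <= \sum_(i < n.+1) (i.+1%:R^-1 : R).
  by rewrite sumr_ge0// => i _; rewrite invr_ge0.
exact: (rate_arith (ler0n R 1591) D0 E1 L00 sigma0 H0 (harmonic_le R n) l0
  (qroot_gt0 R n)).
Qed.
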